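(* Let $Q$ be a finite quiver and $\mathbf d=(d_i)$ a dimension vector. For any $\lambda=\sum_{i\in Q_0}\lambda_ie_i$ and $\mathbf r$ in $R$ with $\sum_{i\in Q_0}\lambda_id_i=0$, there is a unique character $\chi_{\mathbf r}$ of $\mathfrak{gl}_{\mathbf d}(\mathbb K)$ such that $$\mathrm{Tr}^q\Big(\mathbb K\overline Q_\hbar\,\big\{\widehat{[p\mathbf w]}-\widehat{[p\lambda]}+\widehat{[p\mathbf r]}\,\hbar\ \big|\ [p\mathbf w]\in(\mathbb K\overline Q\,\mathbf w\,\mathbb K\overline Q)_\natural\big\}\,\mathbb K\overline Q_\hbar\Big)$$ is contained in $$\Big(\mathcal D_\hbar(\mathrm{Rep}^Q_{\mathbf d})\,\big(\tau+\sum_{i\in Q_0}\lambda_i\,\mathrm{tr}_i-\hbar\chi_{\mathbf r}\big)(\mathfrak{gl}_{\mathbf d}(\mathbb K))\Big)^{\mathfrak{gl}_{\mathbf d}(\mathbb K)}.$$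
   Context: $\mathbb K$ is an algebraically closed field of characteristic zero. $Q$ has vertex set $Q_0$; its arrow set is also written $Q$; $s(a),t(a)$ are source and target. $\overline Q$ adds a reverse arrow $a^*$ for each $a\in Q$ (and $(a^* )^*=a$). $R=\bigoplus_{i\in Q_0}\mathbb Ke_i$; $a\in e_{t(a)}\mathbb K\overline Qe_{s(a)}$. $\mathbf w=\sum_{a\in Q}(aa^*-a^*a)$. For an algebra $C$, $\mathsf{HH}_0(C)=C/[C,C]$; $[x]$ is the class of $x$ and $M_\natural$ the image of $M$. Put $\{a,a^*\}=1$, $\{a^*,a\}=-1$ for $a\in Q$, and $\{f,g\}=0$ for $f,g\in\overline Q$ with $f\neq g^*$. **Quantum path algebra $\mathbb K\overline Q_\hbar$ (Schedler).** Let $E_{\overline Q,h}$ be spanned by $\overline Q\times\mathbb N$ (arrows with heights), an $R$-bimodule via the arrows, $LH=(T_RE_{\overline Q,h})_\natural$ (cyclic words with heights), and $SLH[\hbar]=\mathrm{Sym}(LH)[\hbar]$ with symmetric product $\&$. Let $SLH'$ be the $\mathbb K[\hbar]$-span of elements $$X=(a_{1,1},h_{1,1})\cdots(a_{1,l_1},h_{1,l_1})\&\cdots\&(a_{k,1},h_{k,1})\cdots(a_{k,l_k},h_{k,l_k})\&v_1\&\cdots\&v_m\quad( * )$$ with all heights $h_{i,j}$ distinct, $a_{i,j}\in\overline Q$, $v_i\in Q_0$. Let $\tilde A$ be the quotient of $SLH'$ identifying elements that differ by an order-preserving change of heights. Let $\tilde B\subset\tilde A$ be the $\mathbb K[\hbar]$-submodule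 generated by: (i) $X-X'_{i,j,i',j'}+\hbar X''_{i,j,i',j'}$ for $i\ne i'$, $h_{i,j}<h_{i',j'}$ with no height strictly between them; (ii) $X-X'_{i,j,i,j'}+\hbar X''_{i,j,i,j'}$ for $h_{i,j}<h_{i,j'}$ with no height strictly between them. Here $X'$ is $X$ with the two heights interchanged. $X''_{i,j,i',j'}$ ($i\neq i'$) replaces the $i$-th and $i'$-th cyclic words by the single word $\{a_{i,j},a_{i',j'}\}\,t(a_{i,j+1})(a_{i,j+1},h_{i,j+1})\cdots(a_{i,j-1},h_{i,j-1})(a_{i',j'+1},h_{i',j'+1})\cdots(a_{i',j'-1},h_{i',j'-1})$. $X''_{i,j,i,j'}$ replaces the $i$-th word by $\{a_{i,j},a_{i,j'}\}\,t(a_{i,j'+1})(a_{i,j'+1},h_{i,j'+1})\cdots(a_{i,j-1},h_{i,j-1})\ \&\ t(a_{i,j+1})(a_{i,j+1},h_{i,j+1})\cdots(a_{i,j'-1},h_{i,j'-1})$. (Second indices are cyclic; an idempotent alone remains when no arrows are left.) Then $\mathbb K\overline Q_\hbar=\tilde A/\tilde B$, with product $X*Y$ given by placing $Y$ above $X$ (all heights of $Y$ shifted above those of $X$). **Lifts.** For a closed path $p=x_1\cdots x_v$ at the vertex $k$ ($x_i\in\overline Q$, possibly $v=0$, $p=e_k$), lifts are taken with heights increasing from left to right: $$\widehat{[p\mathbf w]}=\sum_{a\in Q,t(a)=k}(x_1,1)\cdots(x_v,v)(a,v+1)(a^*,v+2)-\sum_{a\in Q,s(a)=k}(x_1,1)\cdots(x_v,v)(a^*,v+1)(a,v+2),$$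 and for $\mathbf s=\sum s_ie_i\in R$, $\widehat{[p\mathbf s]}=s_k(x_1,1)\cdots(x_v,v)$ (equal to $s_ke_k$ if $p=e_k$); extended linearly in $p$ (non-closed paths contribute $0$). The set in the claim is indexed by $p\in\mathbb K\overline Q$, and $\mathbb K\overline Q_\hbar\{\cdots\}\mathbb K\overline Q_\hbar$ is the two-sided ideal it generates. **Differential operators.** $\mathrm{Rep}^Q_{\mathbf d}$ is the space of representations of $Q$ of dimension $\mathbf d$, with coordinates $(a)_{p,q}$ ($1\le p\le d_{t(a)}$, $1\le q\le d_{s(a)}$). $\mathcal D_\hbar(\mathrm{Rep}^Q_{\mathbf d})$ is the Rees algebra of differential operators (order filtration), with $\big[\frac{\partial}{\partial(a)_{p,q}},(b)_{k,l}\big]=\hbar\delta_{a,b}\delta_{p,k}\delta_{q,l}$. For $a\in Q$: $[a]_{p,q}=(a)_{p,q}$, $[a^*]_{p,q}=\frac{\partial}{\partial(a)_{q,p}}$. $\mathfrak{gl}_{\mathbf d}(\mathbb K)=\bigoplus_i\mathfrak{gl}_{d_i}(\mathbb K)$ with elementary matrices $e^i_{p,q}$; $\mathrm{tr}_i$ is the trace of the $i$-th component; a character is a Lie algebra map to $\mathbb K$. The map $$\tau(e^i_{p,q})=\sum_{a\in Q,s(a)=i}\sum_{j=1}^{d_{t(a)}}[a]_{j,p}\frac{\partial}{\partial(a)_{j,q}}-\sum_{a\in Q,t(a)=i}\sum_{j=1}^{d_{s(a)}}[a]_{q,j}\frac{\partial}{\partial(a)_{p,j}}$$ is the infinitesimal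 $\mathrm{GL}_{\mathbf d}$-action, and $v\in\mathfrak{gl}_{\mathbf d}(\mathbb K)$ acts on $\mathcal D_\hbar$ by $v.D=\frac1\hbar[\tau(v),D]$. For a linear map $\theta$ on $\mathfrak{gl}_{\mathbf d}(\mathbb K)$ with values in $\mathcal D_\hbar$, $\mathcal D_\hbar(\mathrm{Rep}^Q_{\mathbf d})\,\theta(\mathfrak{gl}_{\mathbf d}(\mathbb K))$ is the left ideal generated by its image; the superscript $\mathfrak{gl}_{\mathbf d}(\mathbb K)$ denotes invariants. **Quantum trace.** $\mathrm{Tr}^q:\mathbb K\overline Q_\hbar\to\mathcal D_\hbar(\mathrm{Rep}^Q_{\mathbf d})$ is the well-defined $\mathbb K[\hbar]$-linear map sending an element of the form $( * )$ with set of heights $\{1,\dots,N\}$ to $$d_{v_1}\cdots d_{v_m}\sum_{k_{i,j}=1}^{d_{t(a_{i,j})}}\ \prod_{h=1}^N[a_{\phi^{-1}(h)}]_{k_{\phi^{-1}(h)},\,k_{\phi^{-1}(h)+1}},$$ the sum over all indices $k_{i,j}$, the product ordered by increasing $h$, where $\phi(i,j)=h_{i,j}$ and $(i,j)+1=(i,j+1)$ with $j$ modulo $l_i$.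
   Formalization: Uniqueness as stated fails for d ≠ 0 (any character χ with χ(id) ≠ 0 puts ℏ in the left ideal, so the containment is automatic); it is asserted only against characters χ for which ℏ is not in D_ℏ(τ+Σλ_i tr_i−ℏχ)(gl_d). *)

(* Defs.v *)
From HB Require Import structures.
From mathcomp Require Import all_boot all_order all_algebra.
From mathcomp Require Export freeg mpoly.

Set Implicit Arguments.
Unset Strict Implicit.
Unset Printing Implicit Defensive.

Import GRing.Theory.
Local Open Scope ring_scope.

Record quiver := Quiver {
  vertex : finType;
  arrow : finType;
  src : arrow -> vertex;
  tgt : arrow -> vertex }.

Inductive lspan (R : nzRingType) (V : lmodType R) (G : V -> Prop) : V -> Prop :=
| lspan0 : lspan G 0
| lspan_gen x : G x -> lspan G x
| lspan_lin c x y : lspan G x -> lspan G y -> lspan G (c *: x + y).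

Section Double.
Variable Q : quiver.

(* Arrows of the double quiver: (a, false) is a and (a, true) is a^*. *)
Definition darrow : Type := arrow Q * bool.
HB.instance Definition _ := Finite.on darrow.

Definition dsrc (x : darrow) := if x.2 then tgt x.1 else src x.1.
Definition dtgt (x : darrow) := if x.2 then src x.1 else tgt x.1.

(* A word x_1 ... x_v starting (on the left) at the vertex k, that is with
   t(x_1) = k; paths compose as x y <> 0 iff s(x) = t(y). *)
Fixpoint composable (k : vertex Q) (xs : seq darrow) : bool :=
  if xs is x :: xs' then (dtgt x == k) && composable (dsrc x) xs' else true.

Definition wend (k : vertex Q) (xs : seq darrow) : vertex Q :=
  last k (map dsrc xs).

(* The basis of the path algebra of the double; (k, [::]) is e_k. *)
Definition qpath : Type :=
  {p : vertex Q * seq darrow | composable p.1 p.2}.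
HB.instance Definition _ := Choice.on qpath.

(* A cyclic word with heights, given by a representative: (k, [::]) is the
   idempotent e_k, and (k, (a_1, h_1) ... (a_l, h_l)) has base point
   k = t(a_1).  A diagram stands for the symmetric product of its words, so
   [::] is the unit. *)
Definition hletter : Type := darrow * nat.
HB.instance Definition _ := Choice.on hletter.
Definition hword : Type := vertex Q * seq hletter.
HB.instance Definition _ := Choice.on hword.
Definition diagram : Type := seq hword.
HB.instance Definition _ := Choice.on diagram.

Definition letters (X : diagram) : seq hletter :=
  flatten [seq w.2 | w : hword <- X].
Definition heights (X : diagram) : seq nat := [seq l.2 | l : hletter <- letters X].

Definition closed_word (w : hword) : bool :=
  composable w.1 (map fst w.2) && (wend w.1 (map fst w.2) == w.1).

Definition valid (X : diagram) : bool := all closed_word X && uniq (heights X).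

Definition map_heights (f : nat -> nat) (X : diagram) : diagram :=
  [seq (w.1, [seq (l.1, f l.2) | l : hletter <- w.2]) | w : hword <- X].

(* Y placed above X. *)
Definition dmul (X Y : diagram) : diagram :=
  X ++ map_heights (addn (\max_(h <- heights X) h).+1) Y.

End Double.

Notation path_alg K Q := {freeg (qpath Q) / K}.
Notation dfree K Q := {freeg (diagram Q) / {poly K}}.

Section QuantumPathAlgebra.
Variables (K : fieldType) (Q : quiver).

Definition hbar : {poly K} := 'X.

(* {a, a^*} = 1 and {a^*, a} = -1 for a an arrow of Q, 0 otherwise. *)
Definition dbracket (x y : darrow Q) : {poly K} :=
  if (x.1 == y.1) && (x.2 != y.2) then (if x.2 then -1 else 1) else 0.

Local Notation path_alg := (path_alg K Q).
Local Notation dfree := (dfree K Q).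

Definition dbase (X : diagram Q) : dfree := << X >>.

(* Relations defining the quantum path algebra as a quotient of dfree.
   The first four present the K[hbar]-module of the elements of SLH' up to
   order-preserving changes of heights: words that are not closed vanish in
   HH_0 (diagrams with repeated heights are not in SLH' and are discarded too),
   words are cyclic, the product of words is symmetric.
   In the last two, a word and a letter of it can be brought to the front by
   permuting and rotating, so these cover all positions i, j, i', j'; in a
   closed word t(a_(j+1)) = s(a_j), which gives the base points below. *)
Inductive qrelation : dfree -> Prop :=
| qrel_junk X :
    ~~ valid X -> qrelation (dbase X)
| qrel_sym X Y :
    perm_eq X Y -> qrelation (dbase X - dbase Y)
| qrel_rot k x u Z :
    closed_word (k, x :: u) ->
    qrelation (dbase ((k, x :: u) :: Z) - dbase ((dsrc x.1, rcons u x) :: Z))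
| qrel_heights f X :
    {in heights X &, {homo f : h h' / (h < h')%N}} ->
    qrelation (dbase X - dbase (map_heights f X))
| qrel_two k k' a b h h' u u' Z :
    let X := (k, (a, h) :: u) :: (k', (b, h') :: u') :: Z in
    let X' := (k, (a, h') :: u) :: (k', (b, h) :: u') :: Z in
    let X'' := (dsrc a, u ++ u') :: Z in
    valid X -> (h < h')%N -> (forall z, z \in heights X -> ~~ (h < z < h')%N) ->
    qrelation (dbase X - dbase X' + hbar *: (dbracket a b *: dbase X''))
| qrel_one k a b h h' u u' Z :
    let X := (k, (a, h) :: u ++ (b, h') :: u') :: Z in
    let X' := (k, (a, h') :: u ++ (b, h) :: u') :: Z in
    let X'' := (dsrc b, u') :: (dsrc a, u) :: Z in
    valid X -> (h < h')%N -> (forall z, z \in heights X -> ~~ (h < z < h')%N) ->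
    qrelation (dbase X - dbase X' + hbar *: (dbracket a b *: dbase X'')).

(* Elements of the quantum path algebra are represented by elements of dfree;
   x and y represent the same one iff qzero (x - y). *)
Definition qzero : dfree -> Prop := lspan qrelation.

Definition qmul (x y : dfree) : dfree :=
  fglift (fun X => fglift (fun Y => dbase (dmul X Y)) y) x.

(* The elements of dfree representing an element of the two-sided ideal
   generated by (the classes of) G. *)
Definition qideal (G : dfree -> Prop) : dfree -> Prop :=
  lspan (fun z => qrelation z \/
                  exists x g y, G g /\ z = qmul (qmul x g) y).

Definition hlift (k : vertex Q) (xs : seq (darrow Q)) : dfree :=
  dbase [:: (k, zip xs (iota 1 (size xs)))].

Definition path_lift_w (p : qpath Q) : dfree :=
  let: (k, xs) := val p in
  if wend k xs == k then
    \sum_(a : arrow Q | tgt a == k) hlift k (xs ++ [:: (a, false); (a, true)])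
    - \sum_(a : arrow Q | src a == k) hlift k (xs ++ [:: (a, true); (a, false)])
  else 0.

Definition path_lift_s (s : {ffun vertex Q -> K}) (p : qpath Q) : dfree :=
  let: (k, xs) := val p in
  if wend k xs == k then (s k)%:P *: hlift k xs else 0.

Definition path_extend (F : qpath Q -> dfree) (p : path_alg) : dfree :=
  \sum_(q <- dom p) (coeff q p)%:P *: F q.

Definition lift_w : path_alg -> dfree := path_extend path_lift_w.
Definition lift_s (s : {ffun vertex Q -> K}) : path_alg -> dfree :=
  path_extend (path_lift_s s).

(* [p w] lies in the image of the ideal generated by w for every p, so p ranges
   over the whole path algebra. *)
Definition moment_rel (lam r : {ffun vertex Q -> K}) (x : dfree) : Prop :=
  exists p : path_alg, x = lift_w p - lift_s lam p + hbar *: lift_s r p.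

End QuantumPathAlgebra.

Section Representations.
Variables (K : fieldType) (Q : quiver) (d : {ffun vertex Q -> nat}).

Definition coordinate : finType :=
  {a : arrow Q & ('I_(d (tgt a)) * 'I_(d (src a)))%type}.

(* Polynomial functions on Rep_d, with coefficients in K[hbar]. *)
Local Notation fun_rep := {mpoly {poly K}[#|coordinate|]}.

Definition operator : Type := fun_rep -> fun_rep.

(* The Rees algebra (+)_n hbar^n F_n D of the differential operators on Rep_d,
   inside the K[hbar]-linear operators on K[hbar][Rep_d]: it is generated over
   K[hbar] by F_0 D (the functions) and by hbar times the partial derivatives
   (which is what is written d/d(a)_(p,q) in the Rees algebra). *)
Inductive Dhbar : operator -> Prop :=
| Dhbar_mul f : Dhbar (fun g => f * g)
| Dhbar_der i : Dhbar (fun g => hbar K *: mderiv i g)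
| Dhbar_add D E : Dhbar D -> Dhbar E -> Dhbar (fun g => D g + E g)
| Dhbar_comp D E : Dhbar D -> Dhbar E -> Dhbar (fun g => D (E g))
| Dhbar_ext D E : Dhbar D -> D =1 E -> Dhbar E.

(* The index of the coordinate (a)_(p,q); indices are 0-based natural numbers,
   and out-of-range ones never occur below. *)
Definition coord_index (a : arrow Q) (p q : nat) : option 'I_#|coordinate| :=
  match insub p : option 'I_(d (tgt a)), insub q : option 'I_(d (src a)) with
  | Some p', Some q' =>
      Some (enum_rank
        (Tagged (fun a => ('I_(d (tgt a)) * 'I_(d (src a)))%type) (p', q')))
  | _, _ => None
  end.

Definition coord_mul (a : arrow Q) (p q : nat) : operator := fun g =>
  if coord_index a p q is Some i then 'X_i * g else 0.

Definition coord_der (a : arrow Q) (p q : nat) : operator := fun g =>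
  if coord_index a p q is Some i then hbar K *: mderiv i g else 0.

(* The operator [x]_(p,q). *)
Definition entry (x : darrow Q) (p q : nat) : operator :=
  if x.2 then coord_der x.1 q p else coord_mul x.1 p q.

Definition gl : Type := {dffun forall i : vertex Q, 'M[K]_(d i)}.

Definition gl_lin (c : K) (v w : gl) : gl := [ffun i => c *: v i + w i].
Definition gl_bracket (v w : gl) : gl :=
  [ffun i => v i *m w i - w i *m v i].

Definition character (chi : gl -> K) : Prop :=
  (forall c v w, chi (gl_lin c v w) = c * chi v + chi w) /\
  (forall v w, chi (gl_bracket v w) = 0).

Definition tau_elem (i : vertex Q) (p q : 'I_(d i)) : operator := fun g =>
  \sum_(a : arrow Q | src a == i) \sum_(j < d (tgt a))
     coord_mul a j p (coord_der a j q g)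
  - \sum_(a : arrow Q | tgt a == i) \sum_(j < d (src a))
     coord_mul a q j (coord_der a p j g).

Definition tau (v : gl) : operator := fun g =>
  \sum_(i : vertex Q) \sum_(p < d i) \sum_(q < d i)
     (v i p q)%:P *: tau_elem p q g.

Definition theta (lam : {ffun vertex Q -> K}) (chi : gl -> K) (v : gl) :
    operator := fun g =>
  tau v g + (\sum_(i : vertex Q) lam i * \tr (v i))%:P *: g
  - (hbar K * (chi v)%:P) *: g.

Definition left_ideal (th : gl -> operator) (T : operator) : Prop :=
  exists (n : nat) (D : 'I_n -> operator) (v : 'I_n -> gl),
    (forall i, Dhbar (D i)) /\ T =1 (fun g => \sum_(i < n) D i (th (v i) g)).

(* v.D = E, where v.D = (1/hbar) [tau v, D] *)
Definition gl_act (v : gl) (D E : operator) : Prop :=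
  forall g, hbar K *: E g = tau v (D g) - D (tau v g).

Definition invariants (S : operator -> Prop) (T : operator) : Prop :=
  S T /\ forall v, gl_act v T (fun=> 0).

(* The cyclic successor of a letter in its word; the letters of a diagram with
   distinct heights are distinct. *)
Definition next_letter (X : diagram Q) (l : hletter Q) : hletter Q :=
  foldr (fun (w : hword Q) l' => if l \in w.2 then next w.2 l else l') l X.

Definition by_height (X : diagram Q) : seq (hletter Q) :=
  sort (fun l l' : hletter Q => l.2 <= l'.2)%N (letters X).

Definition letter_at (X : diagram Q) (z : 'I_(size (by_height X))) : hletter Q :=
  tnth (in_tuple (by_height X)) z.

Definition succ_pos (X : diagram Q) (z : 'I_(size (by_height X))) :
    'I_(size (by_height X)) :=
  insubd z (index (next_letter X (letter_at z)) (by_height X)).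

(* The index k_(i,j) of the letter at z is k z, ranging over 'I_(d t(a_(i,j))). *)
Definition trace_diagram (X : diagram Q) : operator := fun g =>
  if valid X then
    (\sum_(k : {dffun forall z : 'I_(size (by_height X)),
                  'I_(d (dtgt (letter_at z).1))})
       (\big[(fun D E : operator => D \o E)/idfun]_(z < size (by_height X))
          entry (letter_at z).1 (k z) (k (succ_pos z))) g)
    *+ (\prod_(w <- X | nilp w.2) d w.1)
  else 0.

(* Tr^q, computed on a representative. *)
Definition qtrace (x : dfree K Q) : operator := fun g =>
  fglift (fun X => trace_diagram X g) x.

Definition trace_contained (lam r : {ffun vertex Q -> K}) (chi : gl -> K) :=
  forall x, qideal (moment_rel lam r) x ->
    invariants (left_ideal (theta lam chi)) (qtrace x).

End Representations.

(* Main.v *)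
From HB Require Import structures.
Require Import Defs.
From mathcomp Require Import all_boot all_order all_algebra ring.
From Stdlib Require Import FunctionalExtensionality.

Set Implicit Arguments.
Unset Strict Implicit.
Unset Printing Implicit Defensive.

Import GRing.Theory.
Local Open Scope ring_scope.

(** Write [e_pq(l)] for the matrix unit carried by a letter [l].  The trace of a
    diagram equals a state sum: label every letter [l] by a pair [(p_l, q_l)] of
    independent indices, weight the labelling by the product over the cyclic
    words of [tr (1_k * \prod_l e_(p_l q_l))], and multiply the operators
    [[a_l]_(p_l, q_l)] in the order of the heights ([trace_diagramE]).  The order of
    the operators and the cyclic structure are thereby decoupled: rotating or
    permuting words only concerns the weight, and exchanging two neighbouring
    heights only concerns the operators.

    Three facts follow.  The trace respects the relations of the quantum path
    algebra: exchanging the operators of two neighbouring letters costs their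
    commutator, which is [- hbar {a, b}] when their labels are transposed and 0
    otherwise, and summing the weight over a transposed pair of labels glues two
    words ([contract_two]) or cuts one ([contract_one]), exactly as in [X''].  It
    turns products into compositions ([trace_dmul]).  It takes values in the
    operators commuting with [tau] ([tau_trace_diagram]): the bracket with
    [tau v] replaces a matrix of entries [E] by [hbar (E v - v E)], and around a closed
    word these terms cancel in pairs.

    For a closed path [x] at the vertex [i] the letters of the lift are in
    increasing order, so its trace is that of a product of matrices of operators.
    The two last letters contribute the entry [(m, p)] of
    [\sum_(t a = i) a b - \sum_(s a = i) b a], where [b] is the dual of [a], and
    moving the derivatives to the right turns this entry into
    [- tau (e_pm) - hbar \delta_pm \sum_(s a = i) d_(t a)].  Hence the generator
    [x w - x lambda + hbar x r] has trace
    [- \sum_pm x_pm (tau + \sum lambda tr - hbar chi) (e_pm)] with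
    [chi = \sum_i (r_i - \sum_(s a = i) d_(t a)) tr_i]
    ([qtrace_path_relation]).  This lies in the left ideal; multiplying it on the
    left by a trace is harmless, and on the right as well because traces commute
    with the generators of the left ideal.

    If the inclusion holds for another character [chi'], the case of the trivial
    path at [i] shows that [hbar \sum_p (chi - chi') (e_pp)] lies in the left
    ideal of [chi'].  Unless that ideal contains [hbar], the two characters agree
    on the identity of each [gl_(d_i)], and in characteristic zero this determines
    a character. *)

(** * State sums *)

Section Labelings.
Variable J : Type.
Implicit Types (h : nat) (c : J) (s : nat -> J).

Definition upd h c s : nat -> J := fun z => if z == h then c else s z.

Lemma updE h c s : upd h c s h = c.
Proof. by rewrite /upd eqxx. Qed.

Lemma upd_neq h h' c s : h' != h -> upd h c s h' = s h'.
Proof. by rewrite /upd => /negbTE->. Qed.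

Lemma upd_upd h c c' s : upd h c (upd h c' s) = upd h c s.
Proof.
by apply: functional_extensionality => z; rewrite /upd; case: eqP.
Qed.

Lemma upd_comm h h' c c' s :
  h != h' -> upd h c (upd h' c' s) = upd h' c' (upd h c s).
Proof.
move=> neq; apply: functional_extensionality => z; rewrite /upd.
by case: (eqVneq z h) => [->|//]; rewrite (negbTE neq).
Qed.

End Labelings.

Section StateSum.
Variables (k : comNzRingType) (M : lmodType k) (A : eqType) (J : finType) (j0 : J).
Variable E : A -> J -> {linear M -> M}.
Implicit Types (L : seq (A * nat)) (F : (nat -> J) -> k) (g : M).

(** [L] lists letters with their heights, which serve as names for the labels;
    [E x c] is the operator of the letter [x] labelled [c] and [F] the weight.
    Heights absent from [L] keep the default label [j0]. *)
Fixpoint state_sum L F g : M :=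
  if L is l :: L' then
    \sum_(c : J) E l.1 c (state_sum L' (fun s => F (upd l.2 c s)) g)
  else F (fun=> j0) *: g.

Lemma eq_state_sum L F F' g : F =1 F' -> state_sum L F g = state_sum L F' g.
Proof.
elim: L F F' => [|l L IH] F F' eqF /=; first by rewrite eqF.
by apply: eq_bigr => c _; congr (E _ _ _); apply: IH => s; apply: eqF.
Qed.

Lemma state_sum_linear L F : linear (state_sum L F).
Proof.
elim: L F => [|l L IH] F a x y /=.
  by rewrite scalerDr !scalerA mulrC.
rewrite scaler_sumr -big_split; apply: eq_bigr => c _ /=.
by rewrite IH linearP.
Qed.

HB.instance Definition _ L F :=
  GRing.isLinear.Build k M M _ (state_sum L F) (state_sum_linear L F).

Lemma state_sumDl L a F F' g :
  state_sum L (fun s => a * F s + F' s) g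
  = a *: state_sum L F g + state_sum L F' g.
Proof.
elim: L F F' => [|l L IH] F F' /=; first by rewrite scalerDl scalerA.
rewrite scaler_sumr -big_split; apply: eq_bigr => c _ /=.
by rewrite IH linearP.
Qed.

Lemma state_sum0 L g : state_sum L (fun=> 0) g = 0.
Proof.
elim: L => [|l L IH] /=; first by rewrite scale0r.
by rewrite big1 // => c _; rewrite IH raddf0.
Qed.

Lemma state_sumZ L a F g :
  state_sum L (fun s => a * F s) g = a *: state_sum L F g.
Proof.
rewrite -[RHS]addr0 -(state_sum0 L g) -state_sumDl.
by apply: eq_state_sum => s; rewrite addr0.
Qed.

Lemma state_sum_sum (I : Type) (r : seq I) (F : I -> (nat -> J) -> k) L g :
  state_sum L (fun s => \sum_(i <- r) F i s) g = \sum_(i <- r) state_sum L (F i) g.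
Proof.
elim: r => [|i r IH].
  by rewrite big_nil -[RHS](state_sum0 L g); apply: eq_state_sum => s; rewrite big_nil.
rewrite big_cons -IH -[state_sum _ (F i) _]scale1r -state_sumDl.
by apply: eq_state_sum => s; rewrite big_cons mul1r.
Qed.

Lemma state_sum_sumZ (I : Type) (r : seq I) (a : I -> k)
    (F : I -> (nat -> J) -> k) L g :
  state_sum L (fun s => \sum_(i <- r) a i * F i s) g
  = \sum_(i <- r) a i *: state_sum L (F i) g.
Proof. by rewrite state_sum_sum; apply: eq_bigr => i _; rewrite state_sumZ. Qed.

Definition avoids F h := forall c s, F (upd h c s) = F s.

Lemma avoids_upd F h h' c :
  avoids F h -> avoids (fun s => F (upd h' c s)) h.
Proof.
move=> avF c' s; case: (eqVneq h' h) => [->|neq]; first by rewrite upd_upd.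
by rewrite upd_comm // avF.
Qed.

Lemma state_sum_const L F F' g :
    {in map snd L, forall h, avoids F h} ->
  state_sum L (fun s => F s * F' s) g = F (fun=> j0) *: state_sum L F' g.
Proof.
elim: L F' => [|l L IH] F' avF /=; first by rewrite scalerA.
rewrite scaler_sumr; apply: eq_bigr => c _; rewrite -linearZ /= -IH; last first.
  by move=> h hL; apply: avF; rewrite inE hL orbT.
by congr (E _ _ _); apply: eq_state_sum => s; rewrite avF // inE eqxx.
Qed.

(** A factor of the weight that avoids the labels of the other list is a scalar for
    the operators of that list. *)
Lemma state_sum_cat L1 L2 F1 F2 g :
    {in map snd L1, forall h, avoids F2 h} ->
    {in map snd L2, forall h, avoids F1 h} ->
  state_sum (L1 ++ L2) (fun s => F1 s * F2 s) g
  = state_sum L1 F1 (state_sum L2 F2 g).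
Proof.
elim: L1 F1 => [|l L1 IH] F1 av2 av1 /=; first exact: state_sum_const.
apply: eq_bigr => c _; congr (E _ _ _); rewrite -IH.
- by apply: eq_state_sum => s; rewrite (av2 l.2) // inE eqxx.
- by move=> h hL; apply: av2; rewrite inE hL orbT.
by move=> h hL; apply: avoids_upd; apply: av1.
Qed.

(** The weight of a diagram only sees the heights of its letters, whence the
    restriction of all conditions to a set [H] of heights. *)
Lemma state_sum_rename (H : seq nat) f L F F' g :
    {in H &, injective f} -> {subset map snd L <= H} ->
    (forall s s', {in H, forall h, s' (f h) = s h} -> F' s' = F s) ->
  state_sum [seq (l.1, f l.2) | l <- L] F' g = state_sum L F g.
Proof.
move=> injf; elim: L F F' => [|l L IH] F F' sLH eqF /=; first by rewrite (eqF (fun=> j0)).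
apply: eq_bigr => c _; congr (E _ _ _); apply: IH => [h hL|s s' eqs].
  by apply: sLH; rewrite inE hL orbT.
have lH : l.2 \in H by apply: sLH; rewrite inE eqxx.
apply: eqF => h hH; rewrite /upd (inj_in_eq injf) //.
by case: eqP => // _; apply: eqs.
Qed.

(** Exchanging two consecutive letters costs the commutator of their operators;
    when it is a scalar [kappa], both letters disappear and their labels are
    summed out of the weight. *)
Lemma state_sum_swap L1 L2 a b h h' (kappa : J -> J -> k) F F' F'' g :
    (forall c c' x, E a c (E b c' x) - E b c' (E a c x) = kappa c c' *: x) ->
    h != h' -> h \notin map snd L1 -> h' \notin map snd L1 ->
    (forall c c' s, F' (upd h c' (upd h' c s)) = F (upd h c (upd h' c' s))) ->
    (forall s, F'' s
       = \sum_c \sum_c' kappa c c' * F (upd h c (upd h' c' s))) ->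
  state_sum (L1 ++ (a, h) :: (b, h') :: L2) F g
    - state_sum (L1 ++ (b, h) :: (a, h') :: L2) F' g
  = state_sum (L1 ++ L2) F'' g.
Proof.
move=> comm neq; elim: L1 F F' F'' => [|l L1 IH] F F' F'' /= hL h'L eqF' eqF''.
  rewrite (eq_state_sum _ _ eqF'') state_sum_sum.
  under [RHS]eq_bigr do rewrite state_sum_sumZ.
  under eq_bigr do rewrite raddf_sum.
  under [X in _ - X]eq_bigr do rewrite raddf_sum.
  rewrite [X in _ - X]exchange_big -sumrB; apply: eq_bigr => c _.
  rewrite -sumrB; apply: eq_bigr => c' _; rewrite -comm.
  congr (_ - _); congr (E _ _ (E _ _ _)).
  by apply: eq_state_sum => s; apply: eqF'.
move: hL h'L; rewrite !inE !negb_or => /andP[hl hL] /andP[h'l h'L].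
rewrite -sumrB; apply: eq_bigr => c _; rewrite -raddfB; congr (E _ _ _).
apply: IH => // [c1 c2 s|s].
- have swap h1 h2 d1 d2 : h1 != l.2 -> h2 != l.2 ->
    upd l.2 c (upd h1 d1 (upd h2 d2 s)) = upd h1 d1 (upd h2 d2 (upd l.2 c s)).
    by move=> n1 n2; rewrite (@upd_comm _ l.2 h1) 1?eq_sym // (@upd_comm _ l.2 h2) 1?eq_sym.
  by rewrite !swap.
rewrite eqF''; apply: eq_bigr => c1 _; apply: eq_bigr => c2 _; congr (_ * F _).
by rewrite (@upd_comm _ l.2 h) 1?eq_sym // (@upd_comm _ l.2 h') 1?eq_sym.
Qed.

(** If bracketing with an operator replaces each [E x c] by a combination of the
    [E x c'], with coefficients [kappa x c c'], then moving the coefficients to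
    the weight gives the transposed operator [label_deriv l] on the label of [l].
    It satisfies the Leibniz rule for products in which only one factor depends
    on that label. *)
Section Derivation.
Variable kappa : A -> J -> J -> k.

Definition label_deriv (l : A * nat) F (s : nat -> J) : k :=
  \sum_c kappa l.1 c (s l.2) * F (upd l.2 c s).

Lemma deriv_upd l F h c s :
  h != l.2 -> label_deriv l (fun s' => F (upd h c s')) s = label_deriv l F (upd h c s).
Proof.
move=> neq; rewrite /label_deriv upd_neq 1?eq_sym //; apply: eq_bigr => c' _.
by rewrite upd_comm.
Qed.

Lemma derivMl l F F' s :
  avoids F l.2 -> label_deriv l (fun s => F s * F' s) s = F s * label_deriv l F' s.
Proof.
by move=> av; rewrite mulr_sumr; apply: eq_bigr => c _; rewrite av mulrCA.
Qed.

Lemma derivMr l F F' s :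
  avoids F' l.2 -> label_deriv l (fun s => F s * F' s) s = label_deriv l F s * F' s.
Proof.
by move=> av; rewrite mulr_suml; apply: eq_bigr => c _; rewrite av mulrA.
Qed.

Lemma deriv_sum (I : Type) (r : seq I) (F : I -> (nat -> J) -> k) l s :
  label_deriv l (fun s => \sum_(i <- r) F i s) s = \sum_(i <- r) label_deriv l (F i) s.
Proof.
by rewrite exchange_big; apply: eq_bigr => c _; rewrite mulr_sumr.
Qed.

Lemma eq_deriv l F F' s : F =1 F' -> label_deriv l F s = label_deriv l F' s.
Proof. by move=> eqF; apply: eq_bigr => c _; rewrite eqF. Qed.

(** Leibniz rule: the bracket with a product of operators is the sum of the terms
    where one letter is differentiated. *)
Lemma state_sum_deriv (tau : {linear M -> M}) (eps : k) L F g :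
    (forall x c y, tau (E x c y) - E x c (tau y)
       = eps *: \sum_c' kappa x c c' *: E x c' y) ->
    uniq (map snd L) ->
  tau (state_sum L F g) - state_sum L F (tau g)
  = eps *: \sum_(l <- L) state_sum L (label_deriv l F) g.
Proof.
move=> comm; elim: L F => [|l L IH] F /= uL.
  by rewrite big_nil scaler0 linearZ subrr.
case/andP: uL => lL uL; rewrite raddf_sum -sumrB.
pose Fc c s := F (upd l.2 c s).
transitivity (\sum_c eps *: (\sum_c' kappa l.1 c c' *: E l.1 c' (state_sum L (Fc c) g)
    + E l.1 c (\sum_(l' <- L) state_sum L (label_deriv l' (Fc c)) g))).
  apply: eq_bigr => c _; rewrite scalerDr -comm -linearZ -IH // raddfB.
  by rewrite addrA subrK.
rewrite -scaler_sumr big_split; congr (_ *: _); rewrite big_cons; congr (_ + _).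
  rewrite exchange_big; apply: eq_bigr => c' _.
  under [in RHS]eq_state_sum => s do rewrite /label_deriv updE.
  rewrite state_sum_sumZ raddf_sum; apply: eq_bigr => c _.
  rewrite -linearZ; congr (E _ _ (_ *: _)).
  by apply: eq_state_sum => s; rewrite upd_upd.
under eq_bigr do rewrite raddf_sum.
rewrite exchange_big; apply: eq_big_seq => l' l'L; apply: eq_bigr => c _.
congr (E _ _ _); apply: eq_state_sum => s; rewrite deriv_upd //.
by apply: contraNneq lL => ->; apply: map_f.
Qed.

End Derivation.
End StateSum.

(** * The weight of a labelled diagram *)

Lemma mxtrace_delta_mul (R : comNzRingType) n (A : 'M[R]_n) p q :
  \tr (delta_mx p q *m A) = A q p.
Proof.
rewrite /mxtrace (bigD1 p) //= big1 ?addr0 => [|i neq].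
  rewrite mxE (bigD1 q) //= big1 ?addr0 => [|j neq]; first by rewrite mxE !eqxx mul1r.
  by rewrite mxE (negbTE neq) andbF mul0r.
by rewrite mxE big1 // => j _; rewrite mxE (negbTE neq) mul0r.
Qed.

Lemma mul_delta_mul (R : comNzRingType) m n p q (A : 'M[R]_(m, n)) (B : 'M_(p, q))
    r s i j :
  (A *m delta_mx r s *m B) i j = A i r * B s j.
Proof.
rewrite -(mul_delta_mx (0 : 'I_1)) mulmxA -colE -mulmxA -rowE mxE big_ord1.
by rewrite !mxE.
Qed.

Lemma dim_le_sum (I : finType) (d : I -> nat) i : (d i <= \sum_j d j)%N.
Proof. by rewrite (bigD1 i) //= leq_addr. Qed.

Section Weights.
Variables (K : fieldType) (Q : quiver) (d : {ffun vertex Q -> nat}).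
Variables (n : nat) (dn : forall i, (d i <= n)%N).
Local Notation k := {poly K}.
Local Notation label := ('I_n.+1 * 'I_n.+1)%type.
Local Notation mx := 'M[k]_n.+1.
Implicit Types (i : vertex Q) (x a b : darrow Q) (c : label) (s : nat -> label).
Implicit Types (h : nat) (u : seq (hletter Q)) (w : hword Q) (X Y Z : diagram Q).

(** All the spaces [K^(d i)] are embedded as the first [d i] coordinates of one
    space, so that labels have a type independent of the letter; [proj i] is then
    the identity of the vertex [i]. *)
Definition proj i : mx := pid_mx (d i).

Lemma proj_idem i : proj i *m proj i = proj i.
Proof. by rewrite /proj mul_pid_mx minnn (minn_idPr (leqW (dn i))). Qed.

Lemma projE i (p q : 'I_n.+1) : proj i p q = ((p == q) && (p < d i)%N)%:R.
Proof. by rewrite mxE. Qed.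

Definition fits x c := (c.1 < d (dtgt x))%N && (c.2 < d (dsrc x))%N.

(** The matrix unit of a letter, or 0 if the label is outside of the range of its
    indices.  It is locked so as to be an atom for the associativity of products. *)
Fact letter_mx_key : unit. Proof. by []. Qed.

Definition letter_mx x c : mx :=
  locked_with letter_mx_key (proj (dtgt x) *m delta_mx c.1 c.2 *m proj (dsrc x)).

Lemma letter_mxE x c :
  letter_mx x c = proj (dtgt x) *m delta_mx c.1 c.2 *m proj (dsrc x).
Proof. by rewrite /letter_mx unlock. Qed.

Lemma letter_mx_fits x c : letter_mx x c = (fits x c)%:R *: delta_mx c.1 c.2.
Proof.
apply/matrixP => p q; rewrite letter_mxE !mxE (bigD1 c.2) //= big1 ?addr0 => [|j neq].
  rewrite mxE (bigD1 c.1) //= big1 ?addr0 => [|j neq].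
    rewrite !mxE !eqxx /fits !andbT mulr1.
    rewrite -!natrM !mulnb -[(p == c.1 :> nat)]/(p == c.1) -[(c.2 == q :> nat)]/(c.2 == q).
    rewrite [q == _]eq_sym; congr (nat_of_bool _)%:R.
    case: (eqVneq p c.1) => [->|_]; last by rewrite andbF.
    by rewrite /= -andbA; congr (_ && _); rewrite andbC.
  by rewrite !mxE (negbTE neq) mulr0.
by rewrite mxE big1 ?mul0r // => m _; rewrite !mxE (negbTE neq) andbF mulr0.
Qed.

Lemma proj_letter x c : proj (dtgt x) *m letter_mx x c = letter_mx x c.
Proof. by rewrite letter_mxE !mulmxA proj_idem. Qed.

Lemma letter_proj x c : letter_mx x c *m proj (dsrc x) = letter_mx x c.
Proof. by rewrite letter_mxE -!mulmxA proj_idem. Qed.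

Definition word_mx u s : mx :=
  foldr (fun l : hletter Q => mulmx (letter_mx l.1 (s l.2))) 1%:M u.

Lemma word_mx_cat u v s : word_mx (u ++ v) s = word_mx u s *m word_mx v s.
Proof. by elim: u => [|l u IH] /=; rewrite ?mul1mx // IH mulmxA. Qed.

Lemma word_mx_upd u h c s : h \notin map snd u -> word_mx u (upd h c s) = word_mx u s.
Proof.
elim: u => //= l u IH; rewrite inE negb_or => /andP[neq hu].
by rewrite IH // upd_neq // eq_sym.
Qed.

(** The last letter absorbs the idempotent of its source. *)
Lemma word_mx_proj i u s :
  proj i *m word_mx u s *m proj (wend i (map fst u)) = proj i *m word_mx u s.
Proof.
rewrite /wend; case: u => [|l u] /=; first by rewrite mulmx1 proj_idem.
rewrite -mulmxA; congr (_ *m _); elim: u l => [|l' u IH] l /=.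
  by rewrite mulmx1 letter_proj.
by rewrite -mulmxA IH.
Qed.

(** Without letters this is [d k], which is how the factors [d_(v_i)] of the trace
    appear. *)
Definition word_weight w s : k := \tr (proj w.1 *m word_mx w.2 s).

Definition weight X s : k := \prod_(w <- X) word_weight w s.

Lemma weight_cons w X s : weight (w :: X) s = word_weight w s * weight X s.
Proof. by rewrite /weight big_cons. Qed.

Lemma weight_cat X Y s : weight (X ++ Y) s = weight X s * weight Y s.
Proof. by rewrite /weight big_cat. Qed.

Lemma weight_perm X Y s : perm_eq X Y -> weight X s = weight Y s.
Proof. exact: perm_big. Qed.

(** Cyclicity of the matrix trace; the idempotent at the base point can be moved
    to the end of the first letter because the word is closed. *)
Lemma word_weight_rot i (l : hletter Q) u s :
    closed_word (i, l :: u) ->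
  word_weight (i, l :: u) s = word_weight (dsrc l.1, rcons u l) s.
Proof.
rewrite /closed_word /= => /andP[/andP[/eqP tx _] /eqP ei].
rewrite /word_weight /= -cats1 word_mx_cat /= mulmx1 -{1}tx mulmxA proj_letter.
by rewrite [RHS]mxtrace_mulC -(mulmxA (word_mx u s)) letter_proj mxtrace_mulC.
Qed.

Lemma word_weight_avoids w h :
  h \notin map snd w.2 -> avoids (word_weight w) h.
Proof. by move=> hw c s; rewrite /word_weight word_mx_upd. Qed.

Lemma letters_cons w X : letters (w :: X) = w.2 ++ letters X.
Proof. by []. Qed.

Lemma weight_avoids X h : h \notin heights X -> avoids (weight X) h.
Proof.
rewrite /heights => hX c s; elim: X hX => [|w X IH]; first by rewrite /weight !big_nil.
rewrite letters_cons map_cat mem_cat negb_or => /andP[hw hX].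
by rewrite !weight_cons IH // word_weight_avoids.
Qed.

Lemma weight_rename f X s s' :
  {in heights X, forall h, s' (f h) = s h} -> weight (map_heights f X) s' = weight X s.
Proof.
move=> eqs; rewrite /weight big_map; apply: eq_big_seq => w wX.
have : {in map snd w.2, forall h, s' (f h) = s h}.
  move=> h /mapP[l lw ->]; apply: eqs; apply: map_f; apply/flattenP.
  by exists w.2 => //; apply: map_f.
rewrite /word_weight /=; case: w {wX} => i u /= eqw; congr (\tr (_ *m _)).
elim: u eqw => //= l u IH eqw; rewrite IH; last first.
  by move=> h hu; apply: eqw; rewrite inE hu orbT.
by rewrite eqw // inE eqxx.
Qed.

(** ** Contraction of two dual letters *)

Definition dual x : darrow Q := (x.1, ~~ x.2).

Lemma dsrc_dual x : dsrc (dual x) = dtgt x.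
Proof. by case: x => a []. Qed.

Lemma dtgt_dual x : dtgt (dual x) = dsrc x.
Proof. by case: x => a []. Qed.

(** The commutator of the entries [c] of [a] and [c'] of [b]. *)
Definition contraction a b c c' : k :=
  - hbar K * dbracket K a b * ((c.1 == c'.2) && (c.2 == c'.1) && fits a c)%:R.

Lemma dbracket_neq0 a b : dbracket K a b != 0 -> b = dual a.
Proof.
case: a b => [a e] [b e']; rewrite /dbracket /dual /=.
by case: (eqVneq a b) => [->|_]; case: e e' => [] []; rewrite ?eqxx.
Qed.

Lemma sum_contraction a b (F : label -> label -> k) :
    (forall c c', ~~ fits a c -> F c c' = 0) ->
  \sum_c \sum_c' contraction a b c c' * F c c'
  = - hbar K * dbracket K a b * \sum_p \sum_q F (p, q) (q, p).
Proof.
move=> F0; rewrite [in RHS]pair_bigA mulr_sumr; apply: eq_bigr => -[p q] _.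
rewrite (bigD1 (q, p)) //= big1 ?addr0 => [|[q' p'] neq].
  rewrite /contraction !eqxx /=.
  by case: (boolP (fits a (p, q))) => fit; rewrite ?mulr1 // F0 ?mulr0.
rewrite /contraction /=.
suff /negbTE-> : ~~ ((p == p') && (q == q')) by rewrite mulr0 mul0r.
by apply: contra neq => /andP[/eqP-> /eqP->].
Qed.

Lemma letter_mx_trace a c A :
  \tr (letter_mx a c *m A) = (proj (dsrc a) *m A *m proj (dtgt a)) c.2 c.1.
Proof.
by rewrite letter_mxE -!mulmxA mxtrace_mulC -!mulmxA mxtrace_delta_mul.
Qed.

(** Completeness [\sum_pq e_pq \otimes e_qp = flip]: matrix units [e_pq] and
    [e_qp] in different words fuse these words. *)
Lemma contract_two a A B :
  \sum_p \sum_q \tr (letter_mx a (p, q) *m A) * \tr (letter_mx (dual a) (q, p) *m B)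
  = \tr (proj (dsrc a) *m A *m proj (dtgt a) *m B).
Proof.
transitivity (\tr (proj (dtgt a) *m B *m proj (dsrc a) *m (proj (dsrc a) *m A *m proj (dtgt a)))).
  apply: eq_bigr => p _; rewrite mxE; apply: eq_bigr => q _.
  by rewrite !letter_mx_trace /= dsrc_dual dtgt_dual mulrC.
rewrite mxtrace_mulC !mulmxA -(mulmxA _ (proj _) (proj _)) proj_idem.
by rewrite mxtrace_mulC !mulmxA proj_idem.
Qed.

(** In the same word the same identity reads
    [\sum_pq e_pq A e_qp = tr (A) 1] and splits the word. *)
Lemma contract_one a A B :
  \sum_p \sum_q \tr (letter_mx a (p, q) *m A *m letter_mx (dual a) (q, p) *m B)
  = \tr (proj (dtgt a) *m B) * \tr (proj (dsrc a) *m A).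
Proof.
have tr_proj i (C : mx) : \tr (proj i *m C) = \sum_p (proj i *m C *m proj i) p p.
  by rewrite -{1}proj_idem -mulmxA mxtrace_mulC.
rewrite !tr_proj mulr_suml; apply: eq_bigr => p _.
rewrite mulr_sumr; apply: eq_bigr => q _.
rewrite -2!(mulmxA (letter_mx a _)) letter_mx_trace letter_mxE dsrc_dual dtgt_dual /=.
by rewrite !mulmxA -(mulmxA _ B) -(mulmxA _ (proj _) (B *m _)) mul_delta_mul mulmxA mulrC.
Qed.

Lemma letter_mx_misfit a c : ~~ fits a c -> letter_mx a c = 0.
Proof. by rewrite letter_mx_fits => /negbTE->; rewrite scale0r. Qed.

Lemma contract_weight_two i i' a b h h' u u' Z s :
    let X := (i, (a, h) :: u) :: (i', (b, h') :: u') :: Z in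
    valid X ->
  \sum_c \sum_c' contraction a b c c' * weight X (upd h c (upd h' c' s))
  = - hbar K * dbracket K a b * weight ((dsrc a, u ++ u') :: Z) s.
Proof.
move=> X; rewrite {}/X /valid /heights /closed_word !letters_cons /= !map_cat /= map_cat.
case/andP=> /and3P[/andP[/andP[/eqP ti cu] /eqP ei] /andP[/andP[/eqP ti' cu'] _] _].
case/andP; rewrite mem_cat in_cons mem_cat !negb_or => /and3P[hu hh' /andP[hu' hZ]].
rewrite cat_uniq => /and3P[_ /= /norP[h'u _] /andP[]].
rewrite mem_cat negb_or => /andP[h'u' h'Z] _.
set X := _ :: (_ :: Z).
have wX c c' : weight X (upd h c (upd h' c' s))
  = \tr (letter_mx a c *m word_mx u s) * (\tr (letter_mx b c' *m word_mx u' s) * weight Z s).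
  rewrite /X !weight_cons /word_weight /= !weight_avoids // !word_mx_upd //.
  rewrite updE upd_neq 1?eq_sym // updE -ti -ti' !mulmxA !proj_letter.
  by [].
under eq_bigr => c _ do under eq_bigr => c' _ do rewrite wX.
rewrite sum_contraction => [|c c' /letter_mx_misfit->]; last first.
  by rewrite mul0mx mxtrace0 mul0r.
case: (eqVneq (dbracket K a b) 0) => [->|/dbracket_neq0->]; first by rewrite mulr0 !mul0r.
congr (_ * _); rewrite weight_cons /word_weight /= word_mx_cat mulmxA.
rewrite -word_mx_proj.
have -> : wend (dsrc a) (map fst u) = dtgt a by rewrite ti.
rewrite -contract_two mulr_suml; apply: eq_bigr => p _.
by rewrite mulr_suml; apply: eq_bigr => q _; rewrite mulrA.
Qed.

Lemma contract_weight_one i a b h h' u u' Z s :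
    let X := (i, (a, h) :: u ++ (b, h') :: u') :: Z in
    valid X ->
  \sum_c \sum_c' contraction a b c c' * weight X (upd h c (upd h' c' s))
  = - hbar K * dbracket K a b * weight ((dsrc b, u') :: (dsrc a, u) :: Z) s.
Proof.
move=> X; rewrite {}/X /valid /heights /closed_word !letters_cons /= -!catA !map_cat /= ?map_cat.
case/andP=> /andP[/andP[/andP[/eqP ti cu] /eqP ei] _].
case/andP; rewrite mem_cat in_cons mem_cat !negb_or => /and3P[hu hh' /andP[hu' hZ]].
rewrite cat_uniq => /and3P[_ /= /norP[h'u _] /andP[]].
rewrite mem_cat negb_or => /andP[h'u' h'Z] _.
set X := _ :: Z.
have wX c c' : weight X (upd h c (upd h' c' s))
  = \tr (letter_mx a c *m word_mx u s *m letter_mx b c' *m word_mx u' s) * weight Z s.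
  rewrite /X weight_cons /word_weight /= !word_mx_cat /= !weight_avoids // !word_mx_upd //.
  by rewrite updE upd_neq 1?eq_sym // updE -ti !mulmxA proj_letter.
under eq_bigr => c _ do under eq_bigr => c' _ do rewrite wX.
rewrite sum_contraction => [|c c' /letter_mx_misfit->]; last first.
  by rewrite !mul0mx mxtrace0 mul0r.
case: (eqVneq (dbracket K a b) 0) => [->|/dbracket_neq0->]; first by rewrite mulr0 !mul0r.
congr (_ * _); rewrite !weight_cons /word_weight /= dsrc_dual mulrA.
rewrite -contract_one mulr_suml; apply: eq_bigr => p _.
by rewrite mulr_suml; apply: eq_bigr => q _.
Qed.

(** ** Invariance of weights under base change *)

Section GlAction.
Variable v : gl K d.

(** Locked for the same reason as [letter_mx]. *)
Fact emb_key : unit. Proof. by []. Qed.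

Definition emb i : mx :=
  locked_with emb_key (pid_mx (d i) *m map_mx polyC (v i) *m pid_mx (d i)).

Lemma embE i : emb i = pid_mx (d i) *m map_mx polyC (v i) *m pid_mx (d i).
Proof. by rewrite /emb unlock. Qed.

Lemma proj_emb i : proj i *m emb i = emb i.
Proof. by rewrite embE !mulmxA mul_pid_mx minnn (minn_idPr (leqW (dn i))). Qed.

Lemma emb_proj i : emb i *m proj i = emb i.
Proof. by rewrite embE -!mulmxA mul_pid_mx minnn (minn_idPr (leqW (dn i))). Qed.

(** The coefficient of [E_(c')] in [(E v - v E)_c]. *)
Definition gl_coef x c c' : k :=
  (c.1 == c'.1)%:R * emb (dsrc x) c'.2 c.2 - (c.2 == c'.2)%:R * emb (dtgt x) c.1 c'.1.

Lemma letter_mx_deriv x c' :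
  \sum_c gl_coef x c c' *: letter_mx x c
  = letter_mx x c' *m emb (dsrc x) - emb (dtgt x) *m letter_mx x c'.
Proof.
have coefE : \sum_c gl_coef x c c' *: delta_mx c.1 c.2
    = delta_mx c'.1 c'.2 *m emb (dsrc x) - emb (dtgt x) *m delta_mx c'.1 c'.2 :> mx.
  rewrite [RHS]matrix_sum_delta pair_bigA; apply: eq_bigr => -[p q] _ /=.
  congr (_ *: _); rewrite /gl_coef /= [RHS]mxE; congr (_ + _).
    by rewrite -[delta_mx _ _]mul1mx mul_delta_mul [1%:M _ _]mxE.
  rewrite [RHS]mxE -[_ *m delta_mx _ _]mulmx1 mul_delta_mul [1%:M _ _]mxE mulrC.
  by rewrite [c'.2 == q]eq_sym.
have -> : \sum_c gl_coef x c c' *: letter_mx x c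
  = proj (dtgt x) *m (\sum_c gl_coef x c c' *: delta_mx c.1 c.2) *m proj (dsrc x).
  rewrite mulmx_sumr mulmx_suml; apply: eq_bigr => c _.
  by rewrite letter_mxE -scalemxAr -scalemxAl.
rewrite coefE mulmxBr mulmxBl letter_mxE; congr (_ - _).
  by rewrite -!mulmxA emb_proj proj_emb.
by rewrite !mulmxA proj_emb emb_proj.
Qed.

Local Notation gl_deriv := (label_deriv gl_coef).

Lemma word_mx_avoids u h p q :
  h \notin map snd u -> avoids (fun s => word_mx u s p q) h.
Proof. by move=> hu c s; rewrite word_mx_upd. Qed.

(** Telescoping along a path: at each inner vertex the term [x v] of a letter
    cancels the term [- v y] of the next one. *)
Lemma word_mx_deriv i u s p q :
    composable i (map fst u) -> uniq (map snd u) ->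
  \sum_(l <- u) gl_deriv l (fun s => word_mx u s p q) s
  = (word_mx u s *m emb (wend i (map fst u)) - emb i *m word_mx u s) p q.
Proof.
elim: u i p => [|l u IH] i p /=; first by rewrite big_nil mul1mx mulmx1 subrr mxE.
case/andP=> /eqP <- cu /andP[lu uu]; rewrite big_cons.
have wE l' : gl_deriv l' (fun s => (letter_mx l.1 (s l.2) *m word_mx u s) p q) s
  = \sum_m gl_deriv l' (fun s => letter_mx l.1 (s l.2) p m * word_mx u s m q) s.
  by rewrite -deriv_sum; apply: eq_deriv => s'; rewrite mxE.
have -> : gl_deriv l (fun s => (letter_mx l.1 (s l.2) *m word_mx u s) p q) s
  = ((letter_mx l.1 (s l.2) *m emb (dsrc l.1) - emb (dtgt l.1) *m letter_mx l.1 (s l.2))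
      *m word_mx u s) p q.
  rewrite wE mxE; apply: eq_bigr => m _.
  rewrite derivMr; last exact: word_mx_avoids.
  congr (_ * _); rewrite -letter_mx_deriv summxE; apply: eq_bigr => c _.
  by rewrite mxE updE.
have -> : \sum_(l' <- u) gl_deriv l' (fun s => (letter_mx l.1 (s l.2) *m word_mx u s) p q) s
  = (letter_mx l.1 (s l.2) *m
      (word_mx u s *m emb (wend (dsrc l.1) (map fst u)) - emb (dsrc l.1) *m word_mx u s)) p q.
  under eq_bigr do rewrite wE; rewrite exchange_big mxE; apply: eq_bigr => m _.
  rewrite -(IH (dsrc l.1)) // mulr_sumr; apply: eq_big_seq => l' l'u.
  rewrite derivMl // => c s'; rewrite upd_neq //.
  by apply: contraNneq lu => ->; apply: map_f.
have addE (A B : mx) : A p q + B p q = (A + B) p q by rewrite [RHS]mxE.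
rewrite addE; congr (fun_of_matrix _ _ _).
by rewrite mulmxBl mulmxBr !mulmxA addrC addrA subrK.
Qed.

(** For a closed word the two remaining terms cancel under the trace. *)
Lemma word_weight_deriv w s :
    closed_word w -> uniq (map snd w.2) ->
  \sum_(l <- w.2) gl_deriv l (word_weight w) s = 0.
Proof.
case: w => i u /andP[/= cu /eqP eu] uu.
have trE s' : word_weight (i, u) s' = \sum_p \sum_m proj i p m * word_mx u s' m p.
  by apply: eq_bigr => p _; rewrite mxE.
under eq_bigr do rewrite (eq_deriv _ _ _ trE) deriv_sum.
rewrite exchange_big.
transitivity (\tr (proj i *m (word_mx u s *m emb i - emb i *m word_mx u s))).
  apply: eq_bigr => p _; rewrite mxE.
  under eq_bigr do rewrite deriv_sum.
  rewrite exchange_big; apply: eq_bigr => m _.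
  have := word_mx_deriv s m p cu uu; rewrite eu => <-.
  rewrite mulr_sumr; apply: eq_bigr => l _.
  exact: derivMl.
rewrite mulmxBr raddfB /= !mulmxA proj_emb mxtrace_mulC mulmxA emb_proj.
by rewrite subrr.
Qed.

Lemma weight_deriv X s : valid X -> \sum_(l <- letters X) gl_deriv l (weight X) s = 0.
Proof.
rewrite /valid /heights; elim: X => [|w X IH]; first by rewrite /letters big_nil.
rewrite letters_cons map_cat /= cat_uniq => /andP[/andP[cw cX] /and3P[uw dis uX]].
rewrite big_cat /=.
have wE l : gl_deriv l (weight (w :: X)) s
    = gl_deriv l (fun s => word_weight w s * weight X s) s.
  by apply: eq_deriv => s'; rewrite weight_cons.
under eq_bigr do rewrite wE; under [X in _ + X]eq_bigr do rewrite wE.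
have -> : \sum_(l <- w.2) gl_deriv l (fun s => word_weight w s * weight X s) s
    = (\sum_(l <- w.2) gl_deriv l (word_weight w) s) * weight X s.
  rewrite mulr_suml; apply: eq_big_seq => l lw; apply: derivMr; apply: weight_avoids.
  by apply: contra dis => lX; apply/hasP; exists l.2 => //; apply: map_f.
have -> : \sum_(l <- letters X) gl_deriv l (fun s => word_weight w s * weight X s) s
    = word_weight w s * \sum_(l <- letters X) gl_deriv l (weight X) s.
  rewrite mulr_sumr; apply: eq_big_seq => l lX; apply: derivMl; apply: word_weight_avoids.
  by apply: contra dis => lw; apply/hasP; exists l.2 => //; apply: map_f.
by rewrite word_weight_deriv // IH ?cX // mul0r mulr0 addr0.
Qed.

End GlAction.
End Weights.

(** * Matrix entries as operators *)

Section Entries.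
Variables (K : fieldType) (Q : quiver) (d : {ffun vertex Q -> nat}).
Variables (n : nat) (dn : forall i, (d i <= n)%N).
Local Notation k := {poly K}.
Local Notation label := ('I_n.+1 * 'I_n.+1)%type.
Local Notation M := {mpoly {poly K}[#|coordinate d|]}.
Implicit Types (i : vertex Q) (a b : arrow Q) (x y : darrow Q) (c : label) (f g : M).

Lemma coord_indexP a p q :
  coord_index d a p q = None \/
  exists (p' : 'I_(d (tgt a))) (q' : 'I_(d (src a))),
    [/\ p = p', q = q' &
     coord_index d a p q = Some (enum_rank
        (Tagged (fun a => ('I_(d (tgt a)) * 'I_(d (src a)))%type) (p', q')))].
Proof.
rewrite /coord_index; case: insubP => [p' _ <-|_]; last by left.
by case: insubP => [q' _ <-|_]; [right; exists p', q' | left].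
Qed.

Lemma coord_index_inj a b p q r s z :
    coord_index d a p q = Some z -> coord_index d b r s = Some z ->
  [/\ a = b, p = r & q = s].
Proof.
case: (coord_indexP a p q) => [->|[p' [q' [-> -> ->]]]] // [<-].
case: (coord_indexP b r s) => [->|[r' [s' [-> -> ->]]]] // [/enum_rank_inj eqc].
pose flat (e : coordinate d) := (tag e, val (tagged e).1, val (tagged e).2).
by case: (congr1 flat eqc) => eqa eqp eqq; split; apply: esym.
Qed.

Definition in_range a p q := (p < d (tgt a))%N && (q < d (src a))%N.

Lemma coord_index_range a p q : isSome (coord_index d a p q) = in_range a p q.
Proof.
rewrite /coord_index /in_range; case: insubP => [p' lt _|/negbTE->] //.
by rewrite lt; case: insubP => [q' -> _|/negbTE->].
Qed.

Lemma coord_mul_linear a p q : linear (@coord_mul K Q d a p q).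
Proof.
move=> c f g; rewrite /coord_mul; case: coord_index => [z|]; last by rewrite scaler0 addr0.
by rewrite mulrDr scalerAr.
Qed.

HB.instance Definition _ a p q :=
  GRing.isLinear.Build k M M _ (@coord_mul K Q d a p q) (@coord_mul_linear a p q).

Lemma coord_der_linear a p q : linear (@coord_der K Q d a p q).
Proof.
move=> c f g; rewrite /coord_der; case: coord_index => [z|]; last by rewrite scaler0 addr0.
by rewrite linearP scalerDr !scalerA mulrC.
Qed.

HB.instance Definition _ a p q :=
  GRing.isLinear.Build k M M _ (@coord_der K Q d a p q) (@coord_der_linear a p q).

Lemma coord_mul_out a p q f : ~~ in_range a p q -> coord_mul a p q f = 0.
Proof. by rewrite -coord_index_range /coord_mul; case: coord_index. Qed.

Lemma coord_der_out a p q f : ~~ in_range a p q -> coord_der a p q f = 0.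
Proof. by rewrite -coord_index_range /coord_der; case: coord_index. Qed.

Lemma coord_mulC a b p q r s f :
  coord_mul a p q (coord_mul b r s f) = coord_mul b r s (coord_mul a p q f).
Proof.
rewrite /coord_mul; case: coord_index => [z|]; case: coord_index => [z'|] //.
- exact: mulrCA.
- by rewrite mulr0.
by rewrite mulr0.
Qed.

Lemma coord_derC a b p q r s f :
  coord_der a p q (coord_der b r s f) = coord_der b r s (coord_der a p q f).
Proof.
rewrite /coord_der; case: coord_index => [z|]; case: coord_index => [z'|] //.
- by rewrite !mderivZ mderiv_comm.
- by rewrite raddf0 scaler0.
by rewrite raddf0 scaler0.
Qed.

Lemma mderiv_var (z z' : 'I_#|coordinate d|) :
  mderiv z ('X_z' : M) = (z == z')%:R%:MP.
Proof.
rewrite mderivX mnmE eq_sym; case: eqVneq => [->|_]; last by rewrite scale0r mpolyC0.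
rewrite scale1r mpolyC1 -mpolyX0; congr 'X_[_].
by apply/mnmP => t; rewrite mnmBE subnn mnm0E.
Qed.

Definition same_coord a p q b r s := [&& a == b, p == r, q == s & in_range a p q].

(** The Leibniz rule [d_z (x_z' f) = (z == z') f + x_z' (d_z f)], stated with the
    coordinates of [Rep_d]. *)
Lemma coord_der_mul a b (p q r s : nat) f :
  coord_der a p q (coord_mul b r s f) - coord_mul b r s (coord_der a p q f)
  = (hbar K * (same_coord a p q b r s)%:R) *: f.
Proof.
rewrite /same_coord -coord_index_range /coord_der /coord_mul.
case Ea: (coord_index d a p q) => [z|] /=; last first.
  by rewrite !andbF mulr0 scale0r; case: coord_index => [z|]; rewrite ?mulr0 subr0.
case Eb: (coord_index d b r s) => [z'|]; last first.
  rewrite linear0 scaler0 subr0.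
  suff -> : [&& a == b, p == r, q == s & true] = false by rewrite mulr0 scale0r.
  apply/negP => /and4P[/eqP eqab /eqP eqpr /eqP eqqs _].
  by move: Eb; rewrite -eqab -eqpr -eqqs Ea.
have -> : [&& a == b, p == r, q == s & true] = (z == z').
  apply/idP/eqP => [/and4P[/eqP eqab /eqP eqpr /eqP eqqs _]|eqz].
    by move: Eb; rewrite -eqab -eqpr -eqqs Ea => -[].
  rewrite eqz in Ea; have [-> -> ->] := coord_index_inj Ea Eb.
  by rewrite !eqxx.
rewrite mderivM mderiv_var mul_mpolyC scalerDr -scalerAr addrK.
by rewrite scalerA.
Qed.

Lemma entry_linear x p q : linear (@entry K Q d x p q).
Proof.
by rewrite /entry; case: x.2; [apply: coord_der_linear | apply: coord_mul_linear].
Qed.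

HB.instance Definition _ x p q :=
  GRing.isLinear.Build k M M _ (@entry K Q d x p q) (@entry_linear x p q).

Definition letter_op x c : {linear M -> M} := @entry K Q d x c.1 c.2.

Lemma entry_out x (p q : nat) f :
  ~~ ((p < d (dtgt x)) && (q < d (dsrc x)))%N -> entry x p q f = 0.
Proof.
case: x => a []; rewrite /entry /dtgt /dsrc /= => out; last exact: coord_mul_out.
by apply: coord_der_out; rewrite /in_range andbC.
Qed.

Lemma letter_op_misfit x c f : ~~ fits d x c -> letter_op x c f = 0.
Proof. exact: entry_out. Qed.

(** The canonical commutation relations, in the form in which the bracket of
    the doubled quiver enters the quantum path algebra. *)
Lemma letter_op_comm x y c c' f :
  letter_op x c (letter_op y c' f) - letter_op y c' (letter_op x c f)
  = contraction K d x y c c' *: f.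
Proof.
rewrite /letter_op /contraction /fits /dbracket /entry /=.
case: x y c c' => [a e] [b e'] [p q] [r s]; rewrite /dtgt /dsrc /=.
case: e e' => [] []; rewrite /entry /= ?andbF ?andbT ?mulr0 ?mul0r ?scale0r.
- by rewrite coord_derC subrr.
- rewrite coord_der_mul /same_coord /in_range; congr (_ *: _).
  case: (a == b); rewrite ?mulr0 ?mul0r //= mulrN1 opprK; congr (_ * _%:R).
  by rewrite -[(q == r :> nat)]/(q == r) -[(p == s :> nat)]/(p == s) andbCA !andbA
    -andbA [X in _ && X]andbC andbA.
- rewrite -opprB coord_der_mul /same_coord /in_range -scaleNr; congr (_ *: _).
  rewrite [b == a]eq_sym; case: eqVneq => [->|_]; rewrite ?mulr0 ?mul0r ?oppr0 //= mulr1 mulNr.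
  congr (- (_ * _%:R)).
  rewrite -[(s == p :> nat)]/(s == p) -[(r == q :> nat)]/(r == q) [p == s]eq_sym [q == r]eq_sym.
  by case: (eqVneq s p) => [->|//]; case: (eqVneq r q) => [->|].
by rewrite coord_mulC subrr.
Qed.

(** ** The infinitesimal action on entries *)

Lemma same_coordC a p q b r s : same_coord a p q b r s = same_coord b r s a p q.
Proof.
rewrite /same_coord [b == a]eq_sym; case: eqVneq => [->|//] /=.
rewrite [r == p]eq_sym; case: eqVneq => [->|//] /=.
by rewrite [s == q]eq_sym; case: eqVneq => [->|].
Qed.

Lemma sum_single (I : finType) (P : pred I) (j : I) (F : I -> M) :
  (forall l, l != j -> F l = 0) -> \sum_(l | P l) F l = if P j then F j else 0.
Proof.
move=> F0; rewrite big_mkcond (bigD1 j) //= big1 ?addr0 // => l neq.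
by rewrite F0 // if_same.
Qed.

(** Bracketing [tau_elem p q] with a coordinate leaves one term of the double sum
    over arrows and inner indices; [G] must vanish out of range because the inner
    index only runs over [d (tgt a)] values. *)
Lemma sum_same_coord_row (h : k) i (q : 'I_(d i)) b (r s : nat) (G : arrow Q -> nat -> M) :
    ((d (tgt b) <= r)%N -> G b r = 0) ->
  \sum_(a | src a == i) \sum_(j < d (tgt a)) (h * (same_coord a j q b r s)%:R) *: G a j
  = (h * ((i == src b) && (q == s :> nat))%:R) *: G b r.
Proof.
move=> G0; rewrite (@sum_single _ _ b); last first.
  move=> a /negbTE neq; rewrite big1 // => j _.
  by rewrite /same_coord neq mulr0 scale0r.
rewrite eq_sym; case: eqVneq => [eqi|_]; last by rewrite mulr0 scale0r.
subst i; case: (ltnP r (d (tgt b))) => [lt|ge]; last first.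
  rewrite G0 // scaler0 big1 // => j _; rewrite /same_coord ltn_eqF ?andbF ?mulr0 ?scale0r //.
  exact: leq_trans (ltn_ord j) ge.
rewrite (@sum_single _ _ (Ordinal lt)) /= => [|j neq].
  by rewrite /same_coord /in_range !eqxx lt ltn_ord /= andbT.
rewrite /same_coord (negbTE (_ : (j : nat) != r)) ?andbF ?mulr0 ?scale0r //.
Qed.

Lemma sum_same_coord_col (h : k) i (p : 'I_(d i)) b (r s : nat) (G : arrow Q -> nat -> M) :
    ((d (src b) <= s)%N -> G b s = 0) ->
  \sum_(a | tgt a == i) \sum_(j < d (src a)) (h * (same_coord a p j b r s)%:R) *: G a j
  = (h * ((i == tgt b) && (p == r :> nat))%:R) *: G b s.
Proof.
move=> G0; rewrite (@sum_single _ _ b); last first.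
  move=> a /negbTE neq; rewrite big1 // => j _.
  by rewrite /same_coord neq mulr0 scale0r.
rewrite eq_sym; case: eqVneq => [eqi|_]; last by rewrite mulr0 scale0r.
subst i; case: (ltnP s (d (src b))) => [lt|ge]; last first.
  rewrite G0 // scaler0 big1 // => j _; rewrite /same_coord (@ltn_eqF j) ?andbF ?mulr0 ?scale0r //.
  exact: leq_trans (ltn_ord j) ge.
rewrite (@sum_single _ _ (Ordinal lt)) /= => [|j neq].
  by rewrite /same_coord /in_range !eqxx lt ltn_ord /= andbT.
rewrite /same_coord (negbTE (_ : (j : nat) != s)) ?andbF ?mulr0 ?scale0r //.
Qed.

Lemma mul_der_comm_mul a b p q p' q' r s f :
  coord_mul a p q (coord_der a p' q' (coord_mul b r s f))
    - coord_mul b r s (coord_mul a p q (coord_der a p' q' f))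
  = (hbar K * (same_coord a p' q' b r s)%:R) *: coord_mul a p q f.
Proof. by rewrite -linearZ -coord_der_mul raddfB coord_mulC. Qed.

Lemma mul_der_comm_der a b p q p' q' r s f :
  coord_mul a p q (coord_der a p' q' (coord_der b r s f))
    - coord_der b r s (coord_mul a p q (coord_der a p' q' f))
  = - (hbar K * (same_coord a p q b r s)%:R) *: coord_der a p' q' f.
Proof.
by rewrite coord_derC -opprB coord_der_mul same_coordC scaleNr.
Qed.

(** The entries of [x] form a tensor in [Hom (V_(dsrc x), V_(dtgt x))]; for
    [x = a^*] this holds because derivatives are dual to coordinates. *)
Lemma tau_elem_comm i (p q : 'I_(d i)) x (r s : nat) f :
  tau_elem p q (entry x r s f) - entry x r s (tau_elem p q f)
  = hbar K *: (((i == dsrc x) && (q == s :> nat))%:R *: entry x r p f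
               - ((i == dtgt x) && (p == r :> nat))%:R *: entry x q s f).
Proof.
pose S1 g := \sum_(a | src a == i) \sum_(j < d (tgt a)) coord_mul a j p (coord_der a j q g).
pose S2 g := \sum_(a | tgt a == i) \sum_(j < d (src a)) coord_mul a q j (coord_der a p j g).
have reorg (a b c e : M) : a - b - (c - e) = (a - c) - (b - e).
  by rewrite !opprD !opprK addrACA.
rewrite [tau_elem p q _]/(S1 _ - S2 _) [tau_elem p q f]/(S1 f - S2 f) raddfB reorg scalerBr !scalerA.
case: x => b []; rewrite /entry /dsrc /dtgt /=.
- have -> : S1 (coord_der b s r f) - coord_der b s r (S1 f)
      = - (hbar K * ((i == src b) && (p == r :> nat))%:R) *: coord_der b s q f.
    rewrite -mulNr -(@sum_same_coord_row _ _ _ _ _ _ (fun a j => coord_der a j q f)); last first.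
      by move=> ge; rewrite coord_der_out // /in_range ltnNge ge.
    rewrite raddf_sum -sumrB; apply: eq_bigr => a _.
    rewrite raddf_sum -sumrB; apply: eq_bigr => j _.
    by rewrite mulNr; apply: mul_der_comm_der.
  have -> : S2 (coord_der b s r f) - coord_der b s r (S2 f)
      = - (hbar K * ((i == tgt b) && (q == s :> nat))%:R) *: coord_der b p r f.
    rewrite -mulNr -(@sum_same_coord_col _ _ _ _ _ _ (fun a j => coord_der a p j f)); last first.
      by move=> ge; rewrite coord_der_out // /in_range [(r < _)%N]ltnNge ge andbF.
    rewrite raddf_sum -sumrB; apply: eq_bigr => a _.
    rewrite raddf_sum -sumrB; apply: eq_bigr => j _.
    by rewrite mulNr; apply: mul_der_comm_der.
  by rewrite !scaleNr opprK addrC.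
congr (_ - _).
  rewrite -(@sum_same_coord_row _ _ _ _ _ _ (fun a j => coord_mul a j p f)); last first.
    by move=> ge; rewrite coord_mul_out // /in_range ltnNge ge.
  rewrite raddf_sum -sumrB; apply: eq_bigr => a _.
  rewrite raddf_sum -sumrB; apply: eq_bigr => j _.
  exact: mul_der_comm_mul.
rewrite -(@sum_same_coord_col _ _ _ _ _ _ (fun a j => coord_mul a q j f)); last first.
  by move=> ge; rewrite coord_mul_out // /in_range [(s < _)%N]ltnNge ge andbF.
rewrite raddf_sum -sumrB; apply: eq_bigr => a _.
rewrite raddf_sum -sumrB; apply: eq_bigr => j _.
exact: mul_der_comm_mul.
Qed.

Lemma tau_elem_linear i (p q : 'I_(d i)) : linear (@tau_elem K Q d i p q).
Proof.
move=> c f g; rewrite /tau_elem scalerBr addrACA -opprD.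
congr (_ - _); rewrite scaler_sumr -big_split; apply: eq_bigr => a _ /=;
  rewrite scaler_sumr -big_split; apply: eq_bigr => j _ /=; by rewrite !linearP.
Qed.

HB.instance Definition _ i (p q : 'I_(d i)) :=
  GRing.isLinear.Build k M M _ (@tau_elem K Q d i p q) (@tau_elem_linear i p q).

Lemma tau_linear (v : gl K d) : linear (tau v).
Proof.
move=> c f g; rewrite /tau scaler_sumr -big_split; apply: eq_bigr => i _ /=.
rewrite scaler_sumr -big_split; apply: eq_bigr => p _ /=.
rewrite scaler_sumr -big_split; apply: eq_bigr => q _ /=.
by rewrite linearP scalerDr !scalerA mulrC.
Qed.

HB.instance Definition _ (v : gl K d) :=
  GRing.isLinear.Build k M M _ (tau v) (tau_linear v).

Lemma embE_sum (v : gl K d) i (p q : 'I_n.+1) :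
  emb n v i p q
  = \sum_(p' < d i) \sum_(q' < d i) ((p == p' :> nat) && (q == q' :> nat))%:R * (v i p' q')%:P.
Proof.
rewrite embE mxE exchange_big; apply: eq_bigr => q' _.
rewrite mxE mulr_suml; apply: eq_bigr => p' _; rewrite !mxE !ltn_ord !andbT.
rewrite mulrAC -natrM mulnb [q' == _ :> nat]eq_sym; congr ((nat_of_bool (_ && _))%:R * _).
by case: eqP => [->|//]; rewrite ltn_ord.
Qed.

Lemma gl_coef_src (v : gl K d) x c f :
  \sum_(c' : label) ((c.1 == c'.1)%:R * emb n v (dsrc x) c'.2 c.2) *: letter_op x c' f
  = \sum_(p < d (dsrc x)) \sum_(q < d (dsrc x))
      (v (dsrc x) p q)%:P *: ((q == c.2 :> nat)%:R *: entry x c.1 p f).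
Proof.
rewrite -(pair_bigA _ (fun r s => ((c.1 == r)%:R * emb n v (dsrc x) s c.2) *: letter_op x (r, s) f)).
rewrite (@sum_single _ _ c.1) /= => [|r neq]; last first.
  by rewrite big1 // => s _; rewrite eq_sym (negbTE neq) mul0r scale0r.
under eq_bigr do rewrite eqxx mul1r embE_sum scaler_suml.
rewrite exchange_big; apply: eq_bigr => p _.
under eq_bigr do rewrite scaler_suml.
rewrite exchange_big; apply: eq_bigr => q _.
rewrite (@sum_single _ _ (widen_ord (leqW (dn _)) p)) /= => [|s neq]; last first.
  by rewrite (negbTE (_ : (s : nat) != p)) ?mul0r ?scale0r.
by rewrite eqxx mulrC -scalerA eq_sym.
Qed.

Lemma gl_coef_tgt (v : gl K d) x c f :
  \sum_(c' : label) ((c.2 == c'.2)%:R * emb n v (dtgt x) c.1 c'.1) *: letter_op x c' f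
  = \sum_(p < d (dtgt x)) \sum_(q < d (dtgt x))
      (v (dtgt x) p q)%:P *: ((p == c.1 :> nat)%:R *: entry x q c.2 f).
Proof.
rewrite -(pair_bigA _ (fun r s => ((c.2 == s)%:R * emb n v (dtgt x) c.1 r) *: letter_op x (r, s) f)).
rewrite exchange_big (@sum_single _ _ c.2) /= => [|r neq]; last first.
  by rewrite big1 // => s _; rewrite eq_sym (negbTE neq) mul0r scale0r.
under eq_bigr do rewrite eqxx mul1r embE_sum scaler_suml.
rewrite exchange_big; apply: eq_bigr => p _.
under eq_bigr do rewrite scaler_suml.
rewrite exchange_big; apply: eq_bigr => q _.
rewrite (@sum_single _ _ (widen_ord (leqW (dn _)) q)) /= => [|s neq]; last first.
  by rewrite (negbTE (_ : (s : nat) != q)) ?andbF ?mul0r ?scale0r.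
by rewrite eqxx andbT mulrC -scalerA eq_sym.
Qed.

Lemma tau_letter_op (v : gl K d) x c f :
  tau v (letter_op x c f) - letter_op x c (tau v f)
  = hbar K *: \sum_c' gl_coef v x c c' *: letter_op x c' f.
Proof.
pose F i (e : bool) (p q : 'I_(d i)) g := (v i p q)%:P *: (e%:R *: g) : M.
transitivity (hbar K *: (
    \sum_i \sum_(p < d i) \sum_(q < d i) F i ((i == dsrc x) && (q == c.2 :> nat)) p q (entry x c.1 p f)
  - \sum_i \sum_(p < d i) \sum_(q < d i) F i ((i == dtgt x) && (p == c.1 :> nat)) p q (entry x q c.2 f))).
  rewrite /tau raddf_sum -!sumrB scaler_sumr; apply: eq_bigr => i _.
  rewrite raddf_sum -!sumrB scaler_sumr; apply: eq_bigr => p _.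
  rewrite raddf_sum -!sumrB scaler_sumr; apply: eq_bigr => q _.
  rewrite [X in _ - X = _](_ : _ = (v i p q)%:P *: letter_op x c (tau_elem p q f)); last first.
    exact: linearZ.
  by rewrite -scalerBr tau_elem_comm /F !scalerA mulrC -!scalerA -!scalerBr !scalerA.
congr (_ *: _); rewrite (@sum_single _ _ (dsrc x)) /= => [|i /negbTE neq]; last first.
  by rewrite big1 // => p _; rewrite big1 // => q _; rewrite neq /F scale0r scaler0.
rewrite (@sum_single _ _ (dtgt x)) /= => [|i /negbTE neq]; last first.
  by rewrite big1 // => p _; rewrite big1 // => q _; rewrite neq /F scale0r scaler0.
under [in RHS]eq_bigr do rewrite /gl_coef scalerBl.
rewrite sumrB gl_coef_src gl_coef_tgt; congr (_ - _).
  by apply: eq_bigr => p _; apply: eq_bigr => q _; rewrite eqxx.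
by apply: eq_bigr => p _; apply: eq_bigr => q _; rewrite eqxx.
Qed.

End Entries.

(** * Traces of diagrams as state sums *)

Section FunctionSums.
Variables (J : finType) (V : nmodType).

Definition fcons m (j : J) (c : {ffun 'I_m -> J}) : {ffun 'I_m.+1 -> J} :=
  [ffun z => if unlift ord0 z is Some z' then c z' else j].

Definition fbehead m (c : {ffun 'I_m.+1 -> J}) : {ffun 'I_m -> J} :=
  [ffun z => c (lift ord0 z)].

Lemma fcons0 m j (c : {ffun 'I_m -> J}) : fcons j c ord0 = j.
Proof. by rewrite ffunE unlift_none. Qed.

Lemma fconsS m j (c : {ffun 'I_m -> J}) z : fcons j c (lift ord0 z) = c z.
Proof. by rewrite ffunE liftK. Qed.

Lemma fconsK m j (c : {ffun 'I_m -> J}) : fbehead (fcons j c) = c.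
Proof. by apply/ffunP => z; rewrite ffunE fconsS. Qed.

Lemma sum_fcons m (H : {ffun 'I_m.+1 -> J} -> V) :
  \sum_c H c = \sum_j \sum_c H (fcons j c).
Proof.
rewrite pair_bigA (reindex (fun jc : J * {ffun 'I_m -> J} => fcons jc.1 jc.2)) //=.
exists (fun c : {ffun 'I_m.+1 -> J} => (c ord0, fbehead c)) => [[j c] _|c _] /=.
  by rewrite fcons0 fconsK.
apply/ffunP => z; case: (unliftP ord0 z) => [z' ->|->]; last by rewrite fcons0.
by rewrite fconsS ffunE.
Qed.

End FunctionSums.

Section StateSumUnfolded.
Variables (k : comNzRingType) (M : lmodType k) (A : eqType) (J : finType) (j0 : J).
Variable E : A -> J -> {linear M -> M}.

Fixpoint labeling (L : seq (A * nat)) : {ffun 'I_(size L) -> J} -> nat -> J :=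
  if L is l :: L' return {ffun 'I_(size L) -> J} -> nat -> J
  then fun c => upd l.2 (c ord0) (labeling (fbehead c)) else fun _ _ => j0.

Lemma labelingE L (c : {ffun 'I_(size L) -> J}) z :
  uniq (map snd L) -> labeling c (tnth (in_tuple L) z).2 = c z.
Proof.
elim: L c z => [c []//|l L IH] c z /= /andP[lL uL].
case: (unliftP ord0 z) => [z' ->|->]; last by rewrite (tnth_nth l) /= updE.
rewrite [tnth _ _](tnth_nth l) /= -[nth l L _](tnth_nth l (in_tuple L)) upd_neq; last first.
  by apply: contraNneq lL => <-; apply: map_f; apply: mem_tnth.
by rewrite IH // ffunE.
Qed.

Lemma state_sum_unfold L F g :
  state_sum j0 E L F g
  = \sum_(c : {ffun 'I_(size L) -> J}) F (labeling c) *: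
      (\big[(fun D D' : M -> M => D \o D')/idfun]_(z < size L)
         (E (tnth (in_tuple L) z).1 (c z) : M -> M)) g.
Proof.
elim: L F => [|l L IH] F /=.
  rewrite (big_pred1 [ffun=> j0]) ?big_ord0 // => c.
  by rewrite !inE; apply/esym/eqP/ffunP => -[].
rewrite sum_fcons; apply: eq_bigr => j _; rewrite IH raddf_sum; apply: eq_bigr => c _.
rewrite fcons0 fconsK big_ord_recl /= fcons0 linearZ; congr (_ *: E _ _ _).
congr ((_ : M -> M) g); apply: eq_bigr => z _.
by rewrite fconsS !(tnth_nth l).
Qed.

End StateSumUnfolded.

Section Words.
Variables (Q : quiver).
Implicit Types (X : diagram Q) (l : hletter Q) (w : hword Q).

Lemma heights_uniq_letters X : uniq (heights X) -> uniq (letters X).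
Proof. exact: map_uniq. Qed.

Lemma next_letterE X w l :
  uniq (letters X) -> w \in X -> l \in w.2 -> next_letter X l = next w.2 l.
Proof.
elim: X => //= w' X IH; rewrite [letters _]/= cat_uniq => /and3P[_ /hasPn dis uX].
rewrite inE => /predU1P[->|wX] lw; first by rewrite lw.
rewrite ifN ?IH //; apply: dis; apply/flattenP; exists w.2 => //; exact: map_f.
Qed.

Lemma letterP X l : reflect (exists2 w, w \in X & l \in w.2) (l \in letters X).
Proof.
apply: (iffP flattenP) => [[_ /mapP[w wX ->] lw]|[w wX lw]]; first by exists w.
by exists w.2 => //; apply: map_f.
Qed.

Lemma closed_word_cycle w :
  closed_word w -> cycle (fun l l' : hletter Q => dsrc l.1 == dtgt l'.1) w.2.
Proof.
case: w => i [|l u] //=; rewrite /closed_word /= => /andP[/andP[/eqP ti cu] /eqP eu].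
rewrite rcons_path; apply/andP; split; last first.
  by rewrite ti -[X in _ == X]eu /wend /= -map_comp (last_map (@dsrc Q \o fst)).
elim: u l {ti eu} cu => //= l' u IH l /andP[/eqP tl' cu].
by rewrite tl' eqxx IH.
Qed.

End Words.

Section Bridge.
Variables (K : fieldType) (Q : quiver) (d : {ffun vertex Q -> nat}).
Variables (n : nat) (dn : forall i, (d i <= n)%N).
Local Notation k := {poly K}.
Local Notation label := ('I_n.+1 * 'I_n.+1)%type.
Local Notation M := {mpoly {poly K}[#|coordinate d|]}.
Implicit Types (X : diagram Q) (g : M) (s : nat -> label).

(** A product of matrix units vanishes unless consecutive indices match. *)
Lemma word_mx_delta l u s :
  word_mx K d (l :: u) s
  = (path (fun l l' => (s l.2).2 == (s l'.2).1) l u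
      && all (fun l => fits d l.1 (s l.2)) (l :: u))%:R
    *: delta_mx (s l.2).1 (s (last l u).2).2.
Proof.
elim: u l => [|l' u IH] l; first by rewrite /= mulmx1 letter_mx_fits andbT.
rewrite -[word_mx _ _ _ _]/(_ *m word_mx K d (l' :: u) s) IH letter_mx_fits.
rewrite -scalemxAl -scalemxAr mul_delta_mx_cond scalerA -[delta_mx _ _ *+ _]scaler_nat scalerA -!natrM !mulnb.
congr ((nat_of_bool _)%:R *: _); rewrite /=.
by case: fits; case: path; case: fits; case: all; case: eqP.
Qed.

Lemma word_weightE w s :
    closed_word w ->
  word_weight K d w s
  = (cycle (fun l l' => (s l.2).2 == (s l'.2).1) w.2
      && all (fun l => fits d l.1 (s l.2)) w.2)%:R
    * (if nilp w.2 then d w.1 else 1)%:R.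
Proof.
case: w => i [|l u] cw; rewrite /word_weight.
  rewrite /= mulmx1 mul1r /mxtrace; under eq_bigr do rewrite projE eqxx.
  rewrite -natr_sum -[in RHS](card_ord (d i)) -sum1_card (big_ord_widen _ (fun=> 1%N) (leqW (dn i))).
  by rewrite [in RHS]big_mkcond.
rewrite word_mx_delta -scalemxAr linearZ /= mxtrace_mulC mxtrace_delta_mul projE mulr1.
rewrite -natrM mulnb rcons_path; congr (nat_of_bool _)%:R.
move: cw; rewrite /closed_word /= => /andP[/andP[/eqP<- _] _].
rewrite eq_sym; case: eqP => [<-|_]; last by rewrite !andbF.
rewrite /= andbT; case fit: (fits d l.1 _); last by rewrite /= !andbF.
by case/andP: fit => -> _; rewrite !andbT.
Qed.

Lemma weightE X s :
    all (@closed_word Q) X ->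
  weight K d X s
  = (all (fun w : hword Q => cycle (fun l l' => (s l.2).2 == (s l'.2).1) w.2
      && all (fun l => fits d l.1 (s l.2)) w.2) X)%:R
    * (\prod_(w <- X | nilp w.2) d w.1)%N%:R.
Proof.
elim: X => [|w X IH]; first by rewrite /weight !big_nil mulr1.
move=> /= /andP[cw cX]; rewrite weight_cons IH // word_weightE //.
rewrite mulrACA big_cons; congr (_ * _); first by rewrite -natrM mulnb.
by case: nilp; rewrite ?mul1r // natrM.
Qed.

Definition diagram_op X g : M :=
  state_sum (ord0, ord0) (@letter_op K Q d n) (by_height X) (weight K d X) g.

Lemma by_height_perm X : perm_eq (by_height X) (letters X).
Proof. by rewrite perm_sort. Qed.

(** The weight of a labelling vanishes unless the second index of each letter is the first index of its successor, so a contributing labelling is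
    determined by the first indices, which are the summation indices [k_(i,j)]. *)
Lemma trace_diagramE X g : valid X -> trace_diagram X g = diagram_op X g.
Proof.
move=> vX; have [/allP cX uX] := andP vX.
have uL := heights_uniq_letters uX.
have uB : uniq (map snd (by_height X)) by rewrite (perm_uniq (perm_map _ (by_height_perm X))).
have memB l : (l \in by_height X) = (l \in letters X) by apply/perm_mem/by_height_perm.
have atL (z : 'I_(size (by_height X))) : letter_at z \in letters X.
  by rewrite -memB mem_tnth.
have atP l : l \in letters X -> exists z : 'I_(size (by_height X)), l = letter_at z.
  by rewrite -memB => /(tnthP (in_tuple (by_height X))).
have nextL l : l \in letters X -> next_letter X l \in letters X.
  move=> /letterP[w wX lw]; rewrite (next_letterE uL wX lw); apply/letterP.
  by exists w; rewrite ?mem_next.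
have succE (z : 'I_(size (by_height X))) : letter_at (succ_pos z) = next_letter X (letter_at z).
  rewrite /letter_at (tnth_nth (letter_at z)) val_insubd index_mem memB nextL //.
  by rewrite nth_index // memB nextL.
have srcE (z : 'I_(size (by_height X))) :
    dtgt (letter_at (succ_pos z)).1 = dsrc (letter_at z).1.
  have /letterP[w wX lw] := atL z; rewrite succE (next_letterE uL wX lw).
  by apply/esym/eqP; apply: (next_cycle (closed_word_cycle (cX w wX)) lw).
pose good (c : {ffun 'I_(size (by_height X)) -> label}) :=
  [forall z, ((c z).2 == (c (succ_pos z)).1) && fits d (letter_at z).1 (c z)].
have wE c : weight K d X (labeling (ord0, ord0) c)
    = (good c)%:R * (\prod_(w <- X | nilp w.2) d w.1)%N%:R.
  rewrite weightE; last by apply/allP.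
  have labE z : labeling (ord0, ord0) c (letter_at z).2 = c z by apply: labelingE.
  congr ((nat_of_bool _)%:R * _); apply/allP/forallP => [H z|H w wX].
    have /letterP[w wX lw] := atL z; have /andP[cyc /allP fit] := H w wX.
    have := next_cycle cyc lw; rewrite -(next_letterE uL wX lw) -succE !labE => -> /=.
    by have := fit _ lw; rewrite labE.
  apply/andP; split.
    apply: cycle_from_next => [|l lw].
      apply: subseq_uniq uL; case/splitPr: wX => X1 X2.
      rewrite /letters map_cat flatten_cat /=.
      exact: subseq_trans (prefix_subseq _ _) (suffix_subseq _ _).
    have [z lz] : exists z : 'I_(size (by_height X)), l = letter_at z.
      by apply: atP; apply/letterP; exists w.
    rewrite -(next_letterE uL wX lw) lz -succE !labE.
    by case/andP: (H z).
  apply/allP => l lw; have [z ->] : exists z : 'I_(size (by_height X)), l = letter_at z.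
    by apply: atP; apply/letterP; exists w.
  by rewrite labE; case/andP: (H z).
(* The labelling of a choice of summation indices: the second index of a letter
   is the first index of its successor. *)
pose T := {dffun forall z : 'I_(size (by_height X)), 'I_(d (dtgt (letter_at z).1))}.
pose phi (c : T) : {ffun 'I_(size (by_height X)) -> label} :=
  [ffun z => (inord (c z), inord (c (succ_pos z)))].
have inordE (c : T) z : (inord (c z) : 'I_n.+1) = c z :> nat.
  rewrite inordK // ltnS; exact: leq_trans (ltnW (ltn_ord _)) (dn _).
have phi_inj : injective phi.
  move=> c c' /ffunP eqc; apply/ffunP => z; apply: val_inj.
  by have := congr1 (fun x => val x.1) (eqc z); rewrite !ffunE /= !inordE.
have goodE : good =1 [in phi @: [set: T]].
  move=> c; apply/forallP/imsetP => [gc|[t _ ->] z].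
    have fitc z : ((c z).1 < d (dtgt (letter_at z).1))%N.
      by case/andP: (gc z) => _ /andP[].
    exists (finfun (fun z => Ordinal (fitc z)) : T) => //.
    apply/ffunP => z; rewrite ffunE; case cz: (c z) => [p q]; congr (_, _).
      by apply: val_inj; rewrite /= inordE ffunE /= cz.
    apply: val_inj; rewrite /= inordE ffunE /=.
    by case/andP: (gc z); rewrite cz /= => /eqP->.
  rewrite !ffunE /= eqxx /fits /= !inordE ltn_ord -srcE ltn_ord //.
rewrite /trace_diagram vX /diagram_op state_sum_unfold.
under [RHS]eq_bigr do rewrite wE -scalerA.
rewrite (bigID good) /= [X in _ + X]big1 ?addr0 => [|c /negbTE->]; last by rewrite scale0r.
rewrite (eq_bigl _ _ goodE) big_imset; last exact: in2W phi_inj.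
rewrite -sumrMnl; apply: eq_big => [t|t _]; first by rewrite inE.
have -> : good (phi t) by rewrite goodE imset_f.
rewrite scale1r scaler_nat; congr (_ *+ _); apply: (congr1 (fun D : operator K d => D g)).
by apply: eq_bigr => z _; rewrite /letter_op ffunE /= !inordE.
Qed.

End Bridge.

(** * Letters sorted by height *)

Section ByHeight.
Variable Q : quiver.
Implicit Types (X Y : diagram Q) (L : seq (hletter Q)) (i : vertex Q).

Let below (l l' : hletter Q) := (l.2 <= l'.2)%N.

Let below_trans : transitive below.
Proof. by move=> y x z; apply: leq_trans. Qed.

Lemma uniq_map_inj (T1 T2 : eqType) (f : T1 -> T2) (s : seq T1) :
  uniq (map f s) -> {in s &, injective f}.
Proof.
elim: s => //= x s IH /andP[fx us] y z; rewrite !inE.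
case/predU1P=> [->|ys] /predU1P[->|zs] // eqf; last exact: IH.
  by rewrite eqf map_f in fx.
by rewrite -eqf map_f in fx.
Qed.

Lemma by_height_sorted X : sorted below (by_height X).
Proof. by apply: sort_sorted => l l'; apply: leq_total. Qed.

(** The sorted list is unique because the heights are distinct. *)
Lemma by_heightE X L :
  uniq (heights X) -> perm_eq L (letters X) -> sorted below L -> by_height X = L.
Proof.
move=> uX permL sL; apply: (sorted_eq_in _ _ (by_height_sorted X) sL).
- by move=> ? ? ? _ _ _; apply: below_trans.
- move=> l l'; rewrite !(perm_mem (by_height_perm X)) => lX l'X.
  by rewrite /below -eqn_leq => /eqP; apply: (uniq_map_inj uX).
by rewrite (perm_trans (by_height_perm X)) // perm_sym.
Qed.

Lemma by_height_eq X Y :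
  uniq (heights X) -> perm_eq (letters X) (letters Y) -> by_height X = by_height Y.
Proof.
move=> uX permXY; apply: by_heightE => //; last exact: by_height_sorted.
by rewrite (perm_trans (by_height_perm Y)) // perm_sym.
Qed.

Lemma uniq_by_height X : uniq (heights X) -> uniq (map snd (by_height X)).
Proof. by rewrite (perm_uniq (perm_map snd (by_height_perm X))). Qed.

Lemma by_height_cat X Y :
    uniq (heights (X ++ Y)) ->
    {in heights X & heights Y, forall h h', (h <= h')%N} ->
  by_height (X ++ Y) = by_height X ++ by_height Y.
Proof.
move=> uXY lt; apply: by_heightE => //.
  by rewrite /letters map_cat flatten_cat perm_cat // by_height_perm.
rewrite sorted_pairwise // pairwise_cat -!sorted_pairwise // !by_height_sorted !andbT.
apply/allrelP => l l'; rewrite !(perm_mem (by_height_perm _)) => lX l'Y.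
by apply: lt; apply: map_f.
Qed.

(** A letter sorted between the two would have its height in the gap. *)
Lemma by_height_adjacent X (a b : darrow Q) h h' L :
    uniq (heights X) -> perm_eq (letters X) ((a, h) :: (b, h') :: L) ->
    (h < h')%N -> (forall z, z \in heights X -> ~~ (h < z < h')%N) ->
  exists L1 L2, by_height X = L1 ++ (a, h) :: (b, h') :: L2 /\ perm_eq (L1 ++ L2) L.
Proof.
move=> uX permX lt gap; have uB := uniq_by_height uX.
have aB : (a, h) \in by_height X.
  by rewrite (perm_mem (by_height_perm X)) (perm_mem permX) inE eqxx.
have bB : (b, h') \in by_height X.
  by rewrite (perm_mem (by_height_perm X)) (perm_mem permX) !inE eqxx orbT.
have gapB c : c \in by_height X -> ~~ (h < c.2 < h')%N.
  by rewrite (perm_mem (by_height_perm X)) => cX; apply/gap/map_f.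
have permB : perm_eq (by_height X) ((a, h) :: (b, h') :: L).
  exact: perm_trans (by_height_perm X) permX.
move: (by_height_sorted X); rewrite (sorted_pairwise below_trans).
case/splitPr: aB uB bB gapB permB => L1 L3 uB bB gapB permB.
rewrite pairwise_cat => /and3P[/allrelP le1 _ /= /andP[aL3 sL3]].
have b3 : (b, h') \in L3.
  move: bB; rewrite mem_cat inE => /or3P[bL1|/eqP[_ eqh]|//].
    by have := le1 _ (a, h) bL1 (mem_head _ _); rewrite /below /= leqNgt lt.
  by rewrite eqh ltnn in lt.
case: L3 => [//|c L3] in uB bB gapB permB le1 aL3 sL3 b3 *.
have cB : c \in L1 ++ [:: (a, h), c & L3] by rewrite mem_cat !inE eqxx !orbT.
have hc : (h < c.2)%N.
  move: aL3 uB => /= /andP[le _]; rewrite map_cat cat_uniq ltn_neqAle => /and3P[_ _ /=].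
  by rewrite inE negb_or -andbA => /and3P[-> _ _].
have ch' : (c.2 <= h')%N.
  by move: b3 sL3; rewrite inE => /predU1P[<-//|bL3] /= /andP[/allP/(_ _ bL3)].
have eqc : c = (b, h').
  apply: (uniq_map_inj uB) => //.
  by have := gapB c cB; rewrite hc -leqNgt => h'c; apply/eqP; rewrite eqn_leq ch' h'c.
rewrite eqc in permB *; exists L1, L3; split=> //.
rewrite -(perm_cons (b, h')) -(perm_cons (a, h)) (perm_trans _ permB) //.
by apply/permPl; apply: (perm_catCA [:: (a, h); (b, h')]).
Qed.

Lemma composable_cat i (u v : seq (darrow Q)) :
  composable i (u ++ v) = composable i u && composable (wend i u) v.
Proof. by elim: u i => //= x u IH i; rewrite IH andbA. Qed.

Lemma wend_cat i (u v : seq (darrow Q)) : wend i (u ++ v) = wend (wend i u) v.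
Proof. by rewrite /wend map_cat last_cat. Qed.

Lemma letters_map_heights f X :
  letters (map_heights f X) = [seq (l.1, f l.2) | l <- letters X].
Proof. by rewrite /letters map_flatten -!map_comp. Qed.

Lemma heights_map_heights f X : heights (map_heights f X) = map f (heights X).
Proof. by rewrite /heights letters_map_heights -!map_comp. Qed.

Lemma closed_map_heights f X :
  all (@closed_word Q) (map_heights f X) = all (@closed_word Q) X.
Proof. by rewrite all_map; apply: eq_all => w; rewrite /closed_word /= -map_comp. Qed.

Lemma valid_map_heights f X :
  {in heights X &, injective f} -> valid (map_heights f X) = valid X.
Proof.
by move=> injf; rewrite /valid closed_map_heights heights_map_heights map_inj_in_uniq.
Qed.

Lemma homo_ltn_inj f X :
  {in heights X &, {homo f : h h' / (h < h')%N}} -> {in heights X &, injective f}.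
Proof.
move=> mono h h' hX h'X eqf; case: (ltngtP h h') => // lt.
  by have := mono _ _ hX h'X lt; rewrite eqf ltnn.
by have := mono _ _ h'X hX lt; rewrite eqf ltnn.
Qed.

Lemma by_height_map f X :
    uniq (heights X) -> {in heights X &, {homo f : h h' / (h < h')%N}} ->
  by_height (map_heights f X) = [seq (l.1, f l.2) | l <- by_height X].
Proof.
move=> uX mono; have injf := homo_ltn_inj mono; apply: by_heightE.
- by rewrite heights_map_heights map_inj_in_uniq.
- by rewrite letters_map_heights perm_map // by_height_perm.
apply: (@homo_sorted_in _ _ [in letters X] _ below) (by_height_sorted X).
  move=> l l' lX l'X /=; rewrite /below /= leq_eqVlt => /predU1P[->//|lt].
  by apply/ltnW/mono => //; apply: map_f.
by apply/allP => l; rewrite (perm_mem (by_height_perm X)).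
Qed.

End ByHeight.

(** * Products and invariance of traces *)

Section Representation.
Variables (K : fieldType) (Q : quiver) (d : {ffun vertex Q -> nat}).
Variables (n : nat) (dn : forall i, (d i <= n)%N).
Local Notation k := {poly K}.
Local Notation label := ('I_n.+1 * 'I_n.+1)%type.
Local Notation M := {mpoly {poly K}[#|coordinate d|]}.
Implicit Types (X Y : diagram Q) (g : M) (s : nat -> label).

Lemma diagram_op_eq X Y g :
    uniq (heights X) -> perm_eq (letters X) (letters Y) ->
    (forall s, weight K d X s = weight K d Y s) ->
  diagram_op n X g = diagram_op n Y g.
Proof.
move=> uX perm eqw; rewrite /diagram_op (by_height_eq uX perm).
exact: eq_state_sum.
Qed.

Lemma trace_diagram_map f X g :
  {in heights X &, {homo f : h h' / (h < h')%N}} ->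
  trace_diagram (map_heights f X) g = trace_diagram X g.
Proof.
move=> mono; have injf := homo_ltn_inj mono; have := valid_map_heights injf.
case vX: (valid X) => vfX; last by rewrite /trace_diagram vX vfX.
have /andP[_ uX] := vX.
rewrite !(trace_diagramE dn) // /diagram_op by_height_map //.
apply: (state_sum_rename _ _ _ injf) => [h|s s' eqs].
  by rewrite (perm_mem (perm_map snd (by_height_perm X))).
exact: weight_rename.
Qed.

Lemma trace_dmul X Y g :
  trace_diagram (dmul X Y) g = trace_diagram X (trace_diagram Y g).
Proof.
rewrite /dmul; set m := (\max_(h <- heights X) h).+1.
have mono : {in heights Y &, {homo addn m : h h' / (h < h')%N}}.
  by move=> h h' _ _; rewrite ltn_add2l.
rewrite -(trace_diagram_map g mono); set Y' := map_heights _ Y.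
have lt : {in heights X & heights Y', forall h h', (h < h')%N}.
  move=> h h' hX; rewrite heights_map_heights => /mapP[h1 _ ->].
  by apply: ltn_addr; rewrite /m ltnS (leq_bigmax_seq (F := id)).
have lettersE : letters (X ++ Y') = letters X ++ letters Y'.
  by rewrite /letters map_cat flatten_cat.
have heightsE : heights (X ++ Y') = heights X ++ heights Y'.
  by rewrite /heights lettersE map_cat.
have disj : ~~ has [in heights X] (heights Y').
  by apply/hasPn => h hY; apply/negP => hX; have := lt h h hX hY; rewrite ltnn.
have validE : valid (X ++ Y') = valid X && valid Y'.
  by rewrite /valid all_cat heightsE cat_uniq disj /= andbACA.
case vX: (valid X) validE => /= validE; last by rewrite /trace_diagram validE vX.
case vY: (valid Y') validE => /= validE; last first.
  have -> : trace_diagram Y' g = 0 by rewrite /trace_diagram vY.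
  rewrite (trace_diagramE dn _ vX) /diagram_op raddf0.
  by rewrite /trace_diagram validE.
have /andP[_ uXY] := validE.
rewrite !(trace_diagramE dn) // /diagram_op by_height_cat //; last first.
  by move=> h h' hX hY; apply/ltnW/lt.
rewrite -state_sum_cat.
- by apply: eq_state_sum => s; rewrite weight_cat.
- move=> h; rewrite (perm_mem (perm_map snd (by_height_perm _))) => hX.
  by apply: weight_avoids; apply: contra disj => hY; apply/hasP; exists h.
move=> h; rewrite (perm_mem (perm_map snd (by_height_perm _))) => hY.
by apply: weight_avoids; apply: contra disj => hX; apply/hasP; exists h.
Qed.

(** Traces of closed words are invariant: the infinitesimal action on the
    entries is transposed to an action on the weight, which it annihilates. *)
Lemma tau_trace_diagram (v : gl K d) X g :
  tau v (trace_diagram X g) = trace_diagram X (tau v g).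
Proof.
case vX: (valid X); last by rewrite /trace_diagram vX raddf0.
have /andP[_ uX] := vX; apply/eqP; rewrite -subr_eq0 !(trace_diagramE dn) //.
rewrite (state_sum_deriv _ _ _ (tau_letter_op dn v)); last exact: uniq_by_height.
rewrite -state_sum_sum (_ : state_sum _ _ _ _ _ = 0) ?scaler0 //.
rewrite -[RHS](state_sum0 (ord0, ord0) (@letter_op K Q d n) (by_height X) g).
apply: eq_state_sum => s; rewrite (perm_big _ (by_height_perm X)).
exact: weight_deriv.
Qed.

End Representation.

(** * The relations of the quantum path algebra *)

Lemma fglift_linear (R : nzRingType) (T : choiceType) (V : lmodType R) (f : T -> V) :
  linear (fglift f : {freeg T / R} -> V).
Proof.
have subf : {morph fglift f : x y / x - y} by apply: lift_is_additive.
have f0 : fglift f 0 = 0 by rewrite -[X in fglift f X](subrr 0) subf subrr.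
have addf : {morph fglift f : x y / x + y}.
  by move=> x y; rewrite -{1}[y]opprK subf -[- y]sub0r subf f0 sub0r opprK.
have sumf (r : seq T) (F : T -> {freeg T / R}) :
  fglift f (\sum_(x <- r) F x) = \sum_(x <- r) fglift f (F x) by exact: big_morph.
move=> c x y; rewrite addf; congr (_ + _).
rewrite -{2}(freeg_sumE x) sumf scaler_sumr sumf; apply: eq_bigr => z _.
by rewrite !liftU scalerA.
Qed.

HB.instance Definition _ (R : nzRingType) (T : choiceType) (V : lmodType R) (f : T -> V) :=
  GRing.isLinear.Build R {freeg T / R} V _ (fglift f) (fglift_linear f).

Section Relations.
Variables (K : fieldType) (Q : quiver) (d : {ffun vertex Q -> nat}).
Variables (n : nat) (dn : forall i, (d i <= n)%N).
Local Notation k := {poly K}.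
Local Notation label := ('I_n.+1 * 'I_n.+1)%type.
Local Notation M := {mpoly {poly K}[#|coordinate d|]}.
Implicit Types (X Y Z : diagram Q) (g : M) (s : nat -> label) (u : seq (hletter Q)).

Lemma trace_diagram_perm X Y g :
  perm_eq X Y -> trace_diagram (d := d) X g = trace_diagram Y g :> M.
Proof.
move=> permXY; have permL : perm_eq (letters X) (letters Y).
  by apply: perm_flatten; apply: perm_map.
have validXY : valid X = valid Y.
  by rewrite /valid (perm_all _ permXY) (perm_uniq (perm_map snd permL)).
case vX: (valid X); last by rewrite /trace_diagram vX -validXY vX.
rewrite !(trace_diagramE dn) -?validXY //; apply: diagram_op_eq => //.
  by case/andP: vX.
by move=> s; apply: weight_perm.
Qed.

Lemma trace_diagram_rot i (l : hletter Q) u Z g :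
    closed_word (i, l :: u) ->
  trace_diagram (d := d) ((i, l :: u) :: Z) g
  = trace_diagram ((dsrc l.1, rcons u l) :: Z) g :> M.
Proof.
move=> cw; set X := _ :: Z; set Y := _ :: Z.
have permL : perm_eq (letters X) (letters Y).
  by rewrite !letters_cons perm_cat2r /= perm_sym perm_rcons.
have cw' : closed_word (dsrc l.1, rcons u l).
  move: cw; rewrite /closed_word /= map_rcons -cats1 composable_cat wend_cat /=.
  case/andP=> /andP[/eqP ti ->] /eqP eu; rewrite /wend /= eqxx andbT /=.
  by rewrite ti andbT eq_sym; apply/eqP; exact: eu.
have validXY : valid X = valid Y.
  by rewrite /valid /heights (perm_uniq (perm_map snd permL)) /= cw cw'.
case vX: (valid X); last by rewrite /trace_diagram vX -validXY vX.
rewrite !(trace_diagramE dn) -?validXY //; apply: diagram_op_eq => //.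
  by case/andP: vX.
by move=> s; rewrite !weight_cons word_weight_rot.
Qed.

Definition transpose_heights (h h' z : nat) := if z == h then h' else if z == h' then h else z.

Lemma transpose_heights_inj h h' : injective (transpose_heights h h').
Proof.
move=> z z'; rewrite /transpose_heights.
by do 4?[case: eqP => [->|?]] => //; congruence.
Qed.

Lemma transpose_heights_word h h' u :
    h \notin map snd u -> h' \notin map snd u ->
  [seq (l.1, transpose_heights h h' l.2) | l <- u] = u.
Proof.
move=> hu h'u; apply: map_id_in => -[x z] xu; rewrite /transpose_heights /=.
by rewrite !ifN //; [apply: contraNneq h'u | apply: contraNneq hu] => <-;
  apply: (map_f snd xu).
Qed.

Lemma transpose_heights_diagram h h' Z :
    h \notin heights Z -> h' \notin heights Z ->
  map_heights (transpose_heights h h') Z = Z.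
Proof.
move=> hZ h'Z; apply: map_id_in => -[i u] uZ; rewrite /= transpose_heights_word //.
  by apply: contra hZ => /mapP[l lu ->]; apply/map_f/letterP; exists (i, u).
by apply: contra h'Z => /mapP[l lu ->]; apply/map_f/letterP; exists (i, u).
Qed.

(** The common core of the two quantum relations: the letters [a] and [b] sit at
    consecutive heights and [L] lists the other letters. *)
Lemma trace_diagram_swap X X'' (a b : darrow Q) h h' L g :
    valid X -> perm_eq (letters X) ((a, h) :: (b, h') :: L) ->
    (h < h')%N -> (forall z, z \in heights X -> ~~ (h < z < h')%N) ->
    perm_eq (letters X'') L -> (b = dual a -> valid X'') ->
    (forall s, \sum_c \sum_c' contraction K d a b c c' * weight K d X (upd h c (upd h' c' s))
      = - hbar K * dbracket K a b * weight K d X'' s) ->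
  trace_diagram X g - trace_diagram (map_heights (transpose_heights h h') X) g
    + hbar K *: (dbracket K a b *: trace_diagram X'' g) = 0 :> M.
Proof.
move=> vX permX lt gap permX'' vX'' contr; set X' := map_heights _ X.
have injt : {in heights X &, injective (transpose_heights h h')}.
  by move=> ? ? _ _; apply: transpose_heights_inj.
have vX' : valid X' by rewrite valid_map_heights.
have [_ uX] := andP vX; have [_ uX'] := andP vX'.
have [L1 [L2 [eqB permL]]] := by_height_adjacent uX permX lt gap.
have uB := uniq_by_height uX; rewrite eqB map_cat cat_uniq /= in uB.
have hh' : h != h' by rewrite ltn_eqF.
have [hL1 h'L1] : h \notin map snd L1 /\ h' \notin map snd L1.
  by case/and3P: uB => _ /norP[? /norP[]].
have [hL2 h'L2] : h \notin map snd L2 /\ h' \notin map snd L2.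
  by case/and3P: uB => _ _ /andP[]; rewrite inE negb_or => /andP[_ ->] /andP[->].
have sB := by_height_sorted X; rewrite eqB in sB.
have eqB' : by_height X' = L1 ++ (b, h) :: (a, h') :: L2.
  apply: by_heightE => //.
    rewrite letters_map_heights perm_sym.
    apply: perm_trans (perm_map _ (_ : perm_eq (letters X) (by_height X))) _.
      by rewrite perm_sym by_height_perm.
    rewrite eqB map_cat /= transpose_heights_word // transpose_heights_word //.
    rewrite perm_cat2l /transpose_heights eqxx [h' == h]eq_sym (negbTE hh') eqxx.
    by apply/permPl; apply: (perm_catCA [:: (a, h')] [:: (b, h)]).
  by move: sB; rewrite -!(sorted_map (f := snd) (e' := leq)) !map_cat.
have eqB'' : valid X'' -> by_height X'' = L1 ++ L2.
  move=> /andP[_ uX'']; apply: by_heightE => //.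
    by rewrite (perm_trans permL) // perm_sym.
  apply: subseq_sorted sB; first by move=> ? ? ?; apply: leq_trans.
  by rewrite cat_subseq // -cat1s -[X in subseq _ X]/([:: _; _] ++ _) suffix_subseq.
rewrite (trace_diagramE dn _ vX) (trace_diagramE dn _ vX') /diagram_op eqB eqB'.
rewrite (state_sum_swap (F'' := fun s => - hbar K * dbracket K a b * weight K d X'' s)
  _ _ _ (letter_op_comm (n := n) a b)) //; last first.
  move=> c c' s; apply: weight_rename => z zX; rewrite /transpose_heights /upd.
  case: (eqVneq z h) => [_|neq]; first by rewrite eq_sym (negbTE hh') eqxx.
  by case: (eqVneq z h') => [_|neq']; rewrite ?eqxx ?(negbTE neq) ?(negbTE neq').
rewrite state_sumZ mulNr scaleNr scalerA.
case: (eqVneq (dbracket K a b) 0) => [->|/dbracket_neq0/vX'' {}vX''].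
  by rewrite mulr0 !scale0r oppr0 addr0.
by rewrite (trace_diagramE dn) // /diagram_op eqB'' // addNr.
Qed.

(** In different words the contraction of the two labels is [contract_two]; if [b]
    is dual to [a], gluing produces a closed word. *)
Lemma trace_relation_two i i' (a b : darrow Q) h h' u u' Z g :
    let X := (i, (a, h) :: u) :: (i', (b, h') :: u') :: Z in
    valid X -> (h < h')%N -> (forall z, z \in heights X -> ~~ (h < z < h')%N) ->
  trace_diagram X g - trace_diagram ((i, (a, h') :: u) :: (i', (b, h) :: u') :: Z) g
    + hbar K *: (dbracket K a b *: trace_diagram ((dsrc a, u ++ u') :: Z) g) = 0 :> M.
Proof.
move=> X vX lt gap; have /andP[cX uX] := vX.
set X' := _ :: (_ :: Z); set X'' := _ :: Z.
have permX : perm_eq (letters X) ((a, h) :: (b, h') :: u ++ u' ++ letters Z).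
  rewrite /X !letters_cons /= perm_cons.
  by apply/permPl; apply: (perm_catCA u [:: (b, h')]).
have permX'' : perm_eq (letters X'') (u ++ u' ++ letters Z) by rewrite letters_cons catA.
have uR : uniq (h :: h' :: map snd (u ++ u' ++ letters Z)).
  by rewrite -(perm_uniq (perm_map snd permX)).
have eqX' : X' = map_heights (transpose_heights h h') X.
  move: uR; rewrite /= !map_cat inE !mem_cat !negb_or.
  case/andP=> /and4P[hh' hu hu' hZ] /andP[/and3P[h'u h'u' h'Z] _].
  rewrite /X' /X /map_heights /= -[map _ Z]/(map_heights _ Z).
  rewrite transpose_heights_diagram // !transpose_heights_word //.
  by rewrite /transpose_heights !eqxx [h' == h]eq_sym (negbTE hh').
rewrite eqX'; apply: (trace_diagram_swap _ vX permX lt gap permX'').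
  have uR' : uniq (map snd (u ++ u' ++ letters Z)) by case/andP: uR => _ /andP[].
  move=> eqb; rewrite /valid /heights (perm_uniq (perm_map snd permX'')) uR' andbT.
  move: cX; rewrite /X eqb /= => /and3P[cw cw' ->]; rewrite andbT.
  move: cw cw'; rewrite /closed_word /= map_cat composable_cat wend_cat dsrc_dual dtgt_dual.
  case/andP=> /andP[/eqP ti ->] /eqP eu /andP[/andP[/eqP ti' cu'] /eqP eu'].
  have -> : wend (dsrc a) (map fst u) = dtgt a by rewrite ti.
  by rewrite cu' ti'; apply/eqP; rewrite -[RHS]eu' /wend /= dsrc_dual.
by move=> s; apply: contract_weight_two.
Qed.

(** In the same word the contraction of the two labels is [contract_one]; if [b] is
    dual to [a], both pieces are closed words. *)
Lemma trace_relation_one i (a b : darrow Q) h h' u u' Z g :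
    let X := (i, (a, h) :: u ++ (b, h') :: u') :: Z in
    valid X -> (h < h')%N -> (forall z, z \in heights X -> ~~ (h < z < h')%N) ->
  trace_diagram X g - trace_diagram ((i, (a, h') :: u ++ (b, h) :: u') :: Z) g
    + hbar K *: (dbracket K a b *: trace_diagram ((dsrc b, u') :: (dsrc a, u) :: Z) g)
  = 0 :> M.
Proof.
move=> X vX lt gap; have /andP[cX uX] := vX.
set X' := _ :: Z; set X'' := _ :: (_ :: Z).
have permX : perm_eq (letters X) ((a, h) :: (b, h') :: u ++ u' ++ letters Z).
  rewrite /X !letters_cons /= -catA perm_cons.
  by apply/permPl; apply: (perm_catCA u [:: (b, h')]).
have permX'' : perm_eq (letters X'') (u ++ u' ++ letters Z).
  by rewrite !letters_cons; apply/permPl; apply: perm_catCA.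
have uR : uniq (h :: h' :: map snd (u ++ u' ++ letters Z)).
  by rewrite -(perm_uniq (perm_map snd permX)).
have eqX' : X' = map_heights (transpose_heights h h') X.
  move: uR; rewrite /= !map_cat inE !mem_cat !negb_or.
  case/andP=> /and4P[hh' hu hu' hZ] /andP[/and3P[h'u h'u' h'Z] _].
  rewrite /X' /X /map_heights /= ?map_cat /= -[map _ Z]/(map_heights _ Z).
  rewrite transpose_heights_diagram // !transpose_heights_word //.
  by rewrite /transpose_heights !eqxx [h' == h]eq_sym (negbTE hh').
rewrite eqX'; apply: (trace_diagram_swap _ vX permX lt gap permX'').
  have uR' : uniq (map snd (u ++ u' ++ letters Z)) by case/andP: uR => _ /andP[].
  move=> eqb; rewrite /valid /heights (perm_uniq (perm_map snd permX'')) uR' andbT.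
  move: cX; rewrite /X eqb /= => /andP[cw ->]; rewrite andbT.
  move: cw; rewrite /closed_word /= eqb map_cat composable_cat /= !dsrc_dual dtgt_dual.
  case/andP=> /andP[/eqP ti /and3P[-> /eqP ew ->]] /eqP eu; rewrite -ew eqxx !andbT.
  by apply/eqP; rewrite [RHS]ti -[RHS]eu -cat_cons wend_cat /wend /= dsrc_dual.
by move=> s; apply: contract_weight_one.
Qed.

(** Hence the trace descends to the quantum path algebra. *)
Lemma qtrace_relation x g : qrelation x -> qtrace (d := d) x g = 0 :> M.
Proof.
have baseE X : fglift (fun X => trace_diagram (d := d) X g) (dbase K X)
    = trace_diagram (d := d) X g :> M by rewrite liftU scale1r.
rewrite /qtrace; case=> {x} [X nvX|X Y permXY|i l u Z cw|f X mono
  |i i' a b h h' u u' Z X X' X'' vX lt gap|i a b h h' u u' Z X X' X'' vX lt gap].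
- by rewrite baseE /trace_diagram (negbTE nvX).
- by rewrite raddfB /= !baseE (trace_diagram_perm _ permXY) subrr.
- by rewrite raddfB /= !baseE (trace_diagram_rot _ _ cw) subrr.
- by rewrite raddfB /= !baseE (trace_diagram_map dn) // subrr.
- rewrite raddfD raddfB /= linearZ /= linearZ /= !baseE.
  exact: trace_relation_two.
rewrite raddfD raddfB /= linearZ /= linearZ /= !baseE.
exact: trace_relation_one.
Qed.

End Relations.

(** * Differential operators and left ideals *)

Section Operators.
Variables (K : fieldType) (Q : quiver) (d : {ffun vertex Q -> nat}).
Local Notation k := {poly K}.
Local Notation M := {mpoly {poly K}[#|coordinate d|]}.
Implicit Types (D E : operator K d) (g : M) (v : gl K d).

Lemma Dhbar_linear D : Dhbar D -> linear D.
Proof.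
elim=> {D} [f|z|D E _ lD _ lE|D E _ lD _ lE|D E _ lD eqDE] c x y.
- by rewrite mulrDr scalerAr.
- by rewrite linearP scalerDr !scalerA mulrC.
- by rewrite lD lE scalerDr addrACA.
- by rewrite lE lD.
by rewrite -!eqDE lD.
Qed.

Lemma Dhbar_scale (c : k) : Dhbar (fun g : M => c *: g).
Proof. by apply: Dhbar_ext (Dhbar_mul c%:MP) _ => g; rewrite mul_mpolyC. Qed.

Lemma Dhbar0 : Dhbar (fun _ : M => 0).
Proof. by apply: Dhbar_ext (Dhbar_scale 0) _ => g; rewrite scale0r. Qed.

Lemma Dhbar_sum (I : Type) (r : seq I) (P : pred I) (D : I -> operator K d) :
  (forall i, Dhbar (D i)) -> Dhbar (fun g => \sum_(i <- r | P i) D i g).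
Proof.
move=> DD; elim: r => [|i r IH].
  by apply: Dhbar_ext Dhbar0 _ => g; rewrite big_nil.
case Pi: (P i); last by apply: Dhbar_ext IH _ => g; rewrite big_cons Pi.
by apply: Dhbar_ext (Dhbar_add (DD i) IH) _ => g; rewrite big_cons Pi.
Qed.

Lemma Dhbar_entry (x : darrow Q) (p q : nat) : Dhbar (@entry K Q d x p q).
Proof.
rewrite /entry; case: x.2.
  rewrite /coord_der; case: coord_index => [z|]; [exact: Dhbar_der | exact: Dhbar0].
rewrite /coord_mul; case: coord_index => [z|]; [exact: Dhbar_mul | exact: Dhbar0].
Qed.

Lemma Dhbar_state_sum n L (F : _ -> k) :
  Dhbar (fun g => state_sum (ord0, ord0) (@letter_op K Q d n) L F g).
Proof.
elim: L F => [|l L IH] F /=; first exact: Dhbar_scale.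
by apply: Dhbar_sum => c; apply: Dhbar_comp (Dhbar_entry _ _ _) (IH _).
Qed.

(** ** Left ideals *)

Variable th : gl K d -> operator K d.
Local Notation J := (left_ideal th).

Lemma left_ideal_ext D E : J D -> D =1 E -> J E.
Proof.
case=> n [F [v [DF eqD]]] eqDE; exists n, F, v; split=> // g.
by rewrite -eqDE eqD.
Qed.

Lemma left_ideal0 : J (fun=> 0).
Proof.
exists 0%N, (fun=> id), (fun=> [ffun i => 0]); split=> [[]//|g].
by rewrite big_ord0.
Qed.

Lemma left_ideal_gen v : J (th v).
Proof.
exists 1%N, (fun=> id), (fun=> v); split=> [_|g]; last by rewrite big_ord1.
by apply: Dhbar_ext (Dhbar_scale 1) _ => g; rewrite scale1r.
Qed.

Lemma left_ideal_add D E : J D -> J E -> J (fun g => D g + E g).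
Proof.
case=> m [F [v [DF eqD]]] [m' [F' [v' [DF' eqE]]]].
exists (m + m')%N, (fun i => match split i with inl j => F j | inr j => F' j end),
  (fun i => match split i with inl j => v j | inr j => v' j end).
split=> [i|g]; first by case: split.
rewrite eqD eqE big_split_ord; congr (_ + _); apply: eq_bigr => i _.
  by rewrite (unsplitK (inl i)).
by rewrite (unsplitK (inr i)).
Qed.

Lemma left_ideal_comp D E : Dhbar D -> J E -> J (fun g => D (E g)).
Proof.
move=> DD [m [F [v [DF eqE]]]]; exists m, (fun i => D \o F i), v.
split=> [i|g]; first exact: Dhbar_comp.
rewrite eqE /=; have lD := Dhbar_linear DD.
have D0 : D 0 = 0.
  by have := lD 1 0 0; rewrite !scale1r addr0 => /eqP; rewrite -subr_eq subrr eq_sym => /eqP.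
have addD : {morph D : x y / x + y} by move=> x y; have := lD 1 x y; rewrite !scale1r.
exact: (big_morph D addD D0).
Qed.

Lemma left_ideal_scale (c : k) E : J E -> J (fun g => c *: E g).
Proof. exact/left_ideal_comp/Dhbar_scale. Qed.

Lemma left_ideal_sum (I : Type) (r : seq I) (P : pred I) (D : I -> operator K d) :
  (forall i, P i -> J (D i)) -> J (fun g => \sum_(i <- r | P i) D i g).
Proof.
move=> JD; elim: r => [|i r IH].
  by apply: left_ideal_ext left_ideal0 _ => g; rewrite big_nil.
case Pi: (P i); last by apply: left_ideal_ext IH _ => g; rewrite big_cons Pi.
by apply: left_ideal_ext (left_ideal_add (JD i Pi) IH) _ => g; rewrite big_cons Pi.
Qed.

(** The operator [E] can be moved to the left of the generators. *)
Lemma left_ideal_right D E :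
  Dhbar E -> (forall v g, th v (E g) = E (th v g)) -> J D -> J (fun g => D (E g)).
Proof.
move=> DE comm [m [F [v [DF eqD]]]]; exists m, (fun i => F i \o E), v.
split=> [i|g]; first exact: Dhbar_comp.
by rewrite eqD; apply: eq_bigr => i _; rewrite /= comm.
Qed.

End Operators.

(** * The trace as a map of algebras *)

Section QuantumTrace.
Variables (K : fieldType) (Q : quiver) (d : {ffun vertex Q -> nat}).
Let dn : forall i, (d i <= \sum_j d j)%N := dim_le_sum d.

Local Notation k := {poly K}.
Local Notation M := {mpoly {poly K}[#|coordinate d|]}.
Implicit Types (x y : dfree K Q) (g : M) (v : gl K d) (X : diagram Q).

Lemma fgliftE (T : choiceType) (V : lmodType k) (f : T -> V) (x : {freeg T / k}) :
  fglift f x = \sum_(z <- dom x) coeff z x *: f z.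
Proof.
rewrite -{1}(freeg_sumE x) raddf_sum; apply: eq_bigr => z _.
by rewrite /= liftU.
Qed.

Lemma qtraceE x g : qtrace x g = \sum_(X <- dom x) coeff X x *: trace_diagram X g :> M.
Proof. exact: fgliftE. Qed.

Lemma qtrace_dbase X g : qtrace (dbase K X) g = trace_diagram X g :> M.
Proof. by rewrite /qtrace liftU scale1r. Qed.

Lemma qtraceP (c : k) x y g : qtrace (c *: x + y) g = c *: qtrace x g + qtrace y g :> M.
Proof. exact: fglift_linear. Qed.

Lemma trace_diagram_linear X : linear (@trace_diagram K Q d X).
Proof.
move=> c f g; case vX: (valid X); last by rewrite /trace_diagram vX scaler0 addr0.
by rewrite !(trace_diagramE dn) // /diagram_op linearP.
Qed.

HB.instance Definition _ X :=
  GRing.isLinear.Build k M M _ (@trace_diagram K Q d X) (trace_diagram_linear X).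

Lemma Dhbar_trace_diagram X : Dhbar (@trace_diagram K Q d X).
Proof.
case vX: (valid X); last by apply: (Dhbar_ext (@Dhbar0 K Q d)) => g; rewrite /trace_diagram vX.
apply: (Dhbar_ext (@Dhbar_state_sum K Q d _ (by_height X) (weight K d X))) => g.
by rewrite (trace_diagramE dn).
Qed.

Lemma Dhbar_qtrace x : Dhbar (@qtrace K Q d x).
Proof.
refine (Dhbar_ext _ (fun g => esym (qtraceE x g))); apply: Dhbar_sum => X.
exact: (Dhbar_comp (@Dhbar_scale K Q d _) (Dhbar_trace_diagram X)).
Qed.

Lemma qtrace_sum (I : Type) (r : seq I) (P : pred I) (F : I -> dfree K Q) g :
  qtrace (\sum_(i <- r | P i) F i) g = \sum_(i <- r | P i) qtrace (F i) g :> M.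
Proof. exact: (raddf_sum (fglift (fun X => trace_diagram (d := d) X g : M))). Qed.

(** Placing [Y] above [X] puts the operators of [Y] to the right of those of [X]. *)
Lemma qtrace_mul x y g : qtrace (qmul x y) g = qtrace x (qtrace y g) :> M.
Proof.
have qtraceZ c z f : qtrace (c *: z) f = c *: qtrace z f :> M.
  by have := qtraceP c z 0 f; rewrite addr0 /qtrace raddf0 addr0.
rewrite /qmul (fgliftE _ x) qtrace_sum [RHS]qtraceE; apply: eq_bigr => X _.
rewrite qtraceZ fgliftE qtrace_sum; congr (_ *: _); rewrite (qtraceE y) raddf_sum.
apply: eq_bigr => Y _; rewrite qtraceZ qtrace_dbase (trace_dmul dn).
by apply/esym; exact: linearZ.
Qed.

Lemma tau_qtrace v x g : tau v (qtrace x g) = qtrace x (tau v g) :> M.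
Proof.
rewrite !qtraceE raddf_sum; apply: eq_bigr => X _.
rewrite -(tau_trace_diagram dn); exact: linearZ.
Qed.

End QuantumTrace.

(** * The trace of the moment map relations *)

Section Moment.
Variables (K : fieldType) (Q : quiver) (d : {ffun vertex Q -> nat}).
Variables (n : nat) (dn : forall i, (d i <= n)%N).
Local Notation k := {poly K}.
Local Notation label := ('I_n.+1 * 'I_n.+1)%type.
Local Notation M := {mpoly {poly K}[#|coordinate d|]}.
Local Notation mx := 'M[k]_n.+1.
Implicit Types (i : vertex Q) (xs : seq (darrow Q)) (g : M) (u : seq (hletter Q)).

(** The entry [(p, q)] of the product of the matrices of operators of the letters
    of [xs]. *)
Fixpoint word_op xs (p q : 'I_n.+1) g : M :=
  if xs is x :: xs' then \sum_m letter_op K d x (p, m) (word_op xs' m q g)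
  else (p == q)%:R *: g.

Lemma word_op_linear xs p q : linear (word_op xs p q).
Proof.
elim: xs p => [|x xs IH] p c f g /=; first by rewrite scalerDr !scalerA mulrC.
rewrite scaler_sumr -big_split; apply: eq_bigr => m _ /=.
by rewrite IH linearP.
Qed.

HB.instance Definition _ xs p q :=
  GRing.isLinear.Build k M M _ (word_op xs p q) (word_op_linear xs p q).

Lemma Dhbar_word_op xs p q : Dhbar (word_op xs p q).
Proof.
elim: xs p => [|x xs IH] p; first exact: Dhbar_scale.
by apply: Dhbar_sum => m; apply: Dhbar_comp; [apply: Dhbar_entry | apply: IH].
Qed.

Lemma word_op_cat xs ys p q g :
  word_op (xs ++ ys) p q g = \sum_m word_op xs p m (word_op ys m q g).
Proof.
elim: xs p => [|x xs IH] p /=.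
  rewrite (bigD1 p) //= eqxx scale1r big1 ?addr0 // => m /negbTE.
  by rewrite eq_sym => ->; rewrite scale0r.
under eq_bigr do rewrite IH raddf_sum.
by rewrite exchange_big.
Qed.

Lemma word_op_out xs i (p q : 'I_n.+1) g :
    composable i xs -> (p < d i)%N -> ~~ (q < d (wend i xs))%N ->
  word_op xs p q g = 0.
Proof.
elim: xs i p => [|x xs IH] i p /=.
  move=> _ lt; rewrite /wend /= => ge; case: eqP => [eqpq|_]; last by rewrite scale0r.
  by rewrite -eqpq lt in ge.
move=> /andP[/eqP tx cxs] lt out; rewrite big1 // => m _.
case: (ltnP m (d (dsrc x))) => [ltm|gem].
  by rewrite (IH (dsrc x)) // raddf0.
by apply: entry_out; rewrite [(m < _)%N]ltnNge gem andbF.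
Qed.

(** The list visits the letters in the order of the word, so the matrix product in
    the weight and the composition of the operators can be carried out together. *)
Lemma state_sum_word u (A : mx) g :
    uniq (map snd u) ->
  state_sum (ord0, ord0) (@letter_op K Q d n) u (fun s => \tr (A *m word_mx K d u s)) g
  = \sum_p \sum_q A q p *: word_op (map fst u) p q g.
Proof.
elim: u A => [|l u IH] A /=.
  move=> _; rewrite mulmx1 /mxtrace scaler_suml; apply: eq_bigr => p _.
  rewrite (bigD1 p) //= eqxx scale1r big1 ?addr0 // => q neq.
  by rewrite eq_sym (negbTE neq) scale0r scaler0.
case/andP=> lu uu.
transitivity (\sum_c letter_op K d l.1 c (
    \sum_q A q c.1 *: word_op (map fst u) c.2 q g)).
  apply: eq_bigr => c _; case: (boolP (fits d l.1 c)) => fit; last by rewrite !letter_op_misfit.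
  congr (letter_op _ _ _ _ _).
  transitivity (state_sum (ord0, ord0) (@letter_op K Q d n) u
      (fun s => \tr ((A *m letter_mx K d l.1 c) *m word_mx K d u s)) g).
    by apply: eq_state_sum => s; rewrite updE word_mx_upd // mulmxA.
  rewrite IH // (sum_single _ (j := c.2)) => [|p neq]; last first.
    rewrite big1 // => q _; rewrite letter_mx_fits -scalemxAr mxE -[_ *m delta_mx _ _]mulmx1.
    by rewrite mul_delta_mul mxE eq_sym (negbTE neq) !mulr0 scale0r.
  apply: eq_bigr => q _; rewrite letter_mx_fits fit scale1r -[_ *m delta_mx _ _]mulmx1.
  by rewrite mul_delta_mul mxE eqxx mulr1.
rewrite -(pair_bigA _ (fun p m => letter_op K d l.1 (p, m) (\sum_q A q p *: word_op (map fst u) m q g))) /=.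
apply: eq_bigr => p _; under eq_bigr do rewrite raddf_sum.
rewrite exchange_big; apply: eq_bigr => q _; rewrite scaler_sumr; apply: eq_bigr => m _.
exact: linearZ.
Qed.

Lemma trace_consecutive i xs g :
    composable i xs -> wend i xs = i ->
  trace_diagram [:: (i, zip xs (iota 1 (size xs)))] g
  = \sum_(p < n.+1 | (p < d i)%N) word_op xs p p g.
Proof.
move=> cxs exs; set u := zip _ _; set X := [:: _].
have fstu : map fst u = xs by apply: unzip1_zip; rewrite size_iota.
have sndu : map snd u = iota 1 (size xs) by apply: unzip2_zip; rewrite size_iota.
have lettersX : letters X = u by rewrite letters_cons cats0.
have uX : uniq (heights X) by rewrite /heights lettersX sndu iota_uniq.
have vX : valid X by rewrite /valid uX /closed_word /= fstu cxs exs eqxx.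
have bX : by_height X = u.
  apply: by_heightE; rewrite ?lettersX //.
  by rewrite -(sorted_map (f := snd) (e' := leq)) sndu iota_sorted.
rewrite (trace_diagramE dn) // /diagram_op bX.
transitivity (\sum_p \sum_q proj K d n i q p *: word_op (map fst u) p q g).
  rewrite -state_sum_word ?sndu ?iota_uniq //.
  by apply: eq_state_sum => s; rewrite weight_cons /weight big_nil mulr1.
rewrite fstu [RHS]big_mkcond; apply: eq_bigr => p _.
rewrite (bigD1 p) //= big1 ?addr0 => [|q neq]; last by rewrite projE (negbTE neq) scale0r.
by rewrite projE eqxx; case: ltnP; rewrite ?scale1r ?scale0r.
Qed.

(** ** Elementary matrices *)

(** Indices are natural numbers so that an elementary matrix at [i] has a value at
    every vertex [j] without transport between [d i] and [d j]. *)
Definition gl_elem i (p q : nat) : gl K d :=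
  [ffun j => \matrix_(r, s) [&& j == i, r == p :> nat & s == q :> nat]%:R].

Lemma gl_elem_delta i (p q : 'I_(d i)) : gl_elem i p q i = delta_mx p q.
Proof. by apply/matrixP => r s; rewrite ffunE !mxE eqxx. Qed.

Lemma gl_elem_neq i j (p q : nat) : j != i -> gl_elem i p q j = 0.
Proof. by move=> /negbTE neq; apply/matrixP => r s; rewrite ffunE !mxE neq. Qed.

Lemma tau_gl_elem i (p q : 'I_(d i)) g : tau (gl_elem i p q) g = tau_elem p q g.
Proof.
rewrite /tau (sum_single _ (j := i)) => [|j neq]; last first.
  by rewrite big1 // => r _; rewrite big1 // => s _; rewrite gl_elem_neq // mxE scale0r.
rewrite /= gl_elem_delta (sum_single _ (j := p)) => [|r neq]; last first.
  by rewrite big1 // => s _; rewrite mxE (negbTE neq) scale0r.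
rewrite /= (sum_single _ (j := q)) => [|s neq]; last first.
  by rewrite mxE (negbTE neq) andbF scale0r.
by rewrite /= mxE !eqxx scale1r.
Qed.

(** The correction [\sum_(src a = i) d (tgt a)] to [r i] comes from normal ordering
    ([moment_normal_order]). *)
Definition moment_character (r : {ffun vertex Q -> K}) (v : gl K d) : K :=
  \sum_i (r i - \sum_(a | src a == i) (d (tgt a))%:R) * \tr (v i).

Lemma moment_characterP r : character (moment_character r).
Proof.
split=> [c v w|v w]; rewrite /moment_character.
  rewrite mulr_sumr -big_split; apply: eq_bigr => i _.
  by rewrite ffunE raddfD /= linearZ /= mulrDr mulrCA.
by rewrite big1 // => i _; rewrite ffunE raddfB /= mxtrace_mulC subrr mulr0.
Qed.

Lemma trace_gl_elem i (p q : 'I_(d i)) (F : vertex Q -> K) :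
  \sum_j F j * \tr (gl_elem i p q j) = F i * (p == q)%:R.
Proof.
rewrite (bigD1 i) //= big1 ?addr0 => [|j neq]; last by rewrite gl_elem_neq // mxtrace0 mulr0.
by rewrite gl_elem_delta -[delta_mx p q]mulmx1 mxtrace_delta_mul mxE eq_sym.
Qed.

(** Moving the derivatives of the second sum to the right costs one [hbar] for each
    of the [d (tgt a)] values of the inner index [j] when [p = m]; the result is
    [- tau] because [tau] subtracts the first sum from the second. *)
Lemma moment_normal_order i (p m : 'I_(d i)) g :
  \sum_(a | tgt a == i) \sum_(j < n.+1) coord_mul a m j (coord_der a p j g)
    - \sum_(a | src a == i) \sum_(j < n.+1) coord_der a j m (coord_mul a j p g)
  = - tau_elem p m g - (hbar K * ((\sum_(a | src a == i) (d (tgt a))%:R) * (p == m)%:R)%:P) *: g.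
Proof.
have ordE (a : nat) (F : nat -> M) : (a <= n.+1)%N -> (forall j, (a <= j)%N -> F j = 0) ->
    \sum_(j < n.+1) F j = \sum_(j < a) F j.
  move=> le F0; rewrite (big_ord_widen _ _ le) [RHS]big_mkcond; apply: eq_bigr => j _.
  by case: ltnP => // /F0.
have -> : \sum_(a | tgt a == i) \sum_(j < n.+1) coord_mul a m j (coord_der a p j g)
    = \sum_(a | tgt a == i) \sum_(j < d (src a)) coord_mul a m j (coord_der a p j g).
  apply: eq_bigr => a _; apply: (ordE _ (fun j => coord_mul a m j (coord_der a p j g))).
    exact: leqW (dn _).
  by move=> j ge; rewrite coord_mul_out // /in_range [(j < _)%N]ltnNge ge andbF.
have -> : \sum_(a | src a == i) \sum_(j < n.+1) coord_der a j m (coord_mul a j p g)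
    = \sum_(a | src a == i) \sum_(j < d (tgt a)) coord_mul a j p (coord_der a j m g)
      + (hbar K * ((\sum_(a | src a == i) (d (tgt a))%:R) * (p == m)%:R)%:P) *: g.
  rewrite mulr_suml rmorph_sum mulr_sumr scaler_suml -big_split; apply: eq_bigr => a /eqP sa /=.
  rewrite (ordE (d (tgt a)) (fun j => coord_der a j m (coord_mul a j p g))) ?leqW //; last first.
    move=> j ge; rewrite coord_der_out // /in_range [(j < _)%N]ltnNge ge //.
  transitivity (\sum_(j < d (tgt a)) (coord_mul a j p (coord_der a j m g)
      + (hbar K * (p == m)%:R) *: g)).
    apply: eq_bigr => j _; apply/eqP; rewrite addrC -subr_eq coord_der_mul.
    by rewrite /same_coord /in_range !eqxx /= sa !ltn_ord !andbT [m == p :> nat]eq_sym.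
  rewrite big_split /= sumr_const card_ord; congr (_ + _).
  by rewrite -scaler_nat scalerA rmorphM /= !rmorph_nat mulrCA.
by rewrite /tau_elem opprD opprB addrA.
Qed.

End Moment.

(** * Traces of the generators *)

Section Containment.
Variables (K : fieldType) (Q : quiver) (d : {ffun vertex Q -> nat}).
Local Notation k := {poly K}.
Local Notation M := {mpoly {poly K}[#|coordinate d|]}.
Implicit Types (i : vertex Q) (xs ys : seq (darrow Q)) (g : M) (lam r : {ffun vertex Q -> K}).

Local Notation n := (\sum_i d i)%N.

Let dn : forall i, (d i <= n)%N := dim_le_sum d.

Local Notation widen := (widen_ord (leqW (dn _))).

Lemma qtrace_scale (c : k) x g : qtrace (c *: x) g = c *: qtrace x g :> M.
Proof. by have := qtraceP c x 0 g; rewrite addr0 /qtrace raddf0 addr0. Qed.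

Lemma qtrace_add x y g : qtrace (x + y) g = qtrace x g + qtrace y g :> M.
Proof. by have := qtraceP 1 x y g; rewrite !scale1r. Qed.

Lemma qtrace_sub x y g : qtrace (x - y) g = qtrace x g - qtrace y g :> M.
Proof. by rewrite -scaleN1r qtrace_add qtrace_scale scaleN1r. Qed.

(** Cutting at the base point; the index [m] at the cut stays below [d i] because
    [xs] ends at [i]. *)
Lemma qtrace_loops i xs ys g :
    composable i xs -> wend i xs = i -> composable i ys -> wend i ys = i ->
  qtrace (hlift K i (xs ++ ys)) g
  = \sum_(p < d i) \sum_(m < d i)
      word_op (n := n) xs (widen p) (widen m) (word_op ys (widen m) (widen p) g) :> M.
Proof.
move=> cxs exs cys eys; rewrite qtrace_dbase (trace_consecutive dn); last first.
- by rewrite wend_cat exs.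
- by rewrite composable_cat cxs exs.
rewrite (big_ord_narrow (leqW (dn i))); apply: eq_bigr => p _.
rewrite word_op_cat (bigID (fun m : 'I_n.+1 => m < d i)%N) /= [X in _ + X]big1 ?addr0.
  by rewrite (big_ord_narrow (leqW (dn i))).
by move=> m out; apply: (word_op_out _ cxs); [apply: (ltn_ord p) | rewrite exs].
Qed.

Lemma word_op_two x y (m p : 'I_n.+1) g :
  word_op [:: x; y] m p g = \sum_(j < n.+1) entry x m j (entry y j p g) :> M.
Proof.
apply: eq_bigr => j _ /=; congr (entry _ _ _ _).
rewrite (sum_single _ (j := p)) /= => [|l /negbTE->]; last by rewrite scale0r raddf0.
by rewrite eqxx scale1r.
Qed.

(** The lift of [x w] contributes [tau] and a multiple of [hbar] on the diagonal by
    [moment_normal_order]; the lifts of [x lambda] and [x r] are diagonal. *)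
Lemma qtrace_path_relation lam r i xs (pq : composable i xs) g :
    wend i xs = i ->
  let q : qpath Q := exist _ (i, xs) pq in
  qtrace (path_lift_w K q - path_lift_s lam q + hbar K *: path_lift_s r q) g
  = - \sum_(p < d i) \sum_(m < d i)
      word_op (n := n) xs (widen p) (widen m)
        (theta lam (moment_character (d := d) r) (gl_elem K d i p m) g) :> M.
Proof.
move=> exs q; rewrite qtrace_add qtrace_sub qtrace_scale.
have liftE s : qtrace (path_lift_s s q) g = (s i)%:P *: qtrace (hlift K i xs) g :> M.
  by rewrite /path_lift_s /= exs eqxx; exact: qtrace_scale.
rewrite !liftE /path_lift_w /= exs eqxx qtrace_sub !qtrace_sum.
have sE : qtrace (hlift K i xs) g
  = \sum_(p < d i) \sum_(m < d i) word_op (n := n) xs (widen p) (widen m)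
      ((m == p)%:R *: g) :> M.
  by rewrite -[xs in LHS]cats0 qtrace_loops.
have wE (e : bool) (P : pred (arrow Q)) : (forall a, P a -> dtgt (a, e) == i) ->
    \sum_(a | P a) qtrace (hlift K i (xs ++ [:: (a, e); (a, ~~ e)])) g
  = \sum_(p < d i) \sum_(m < d i) word_op (n := n) xs (widen p) (widen m)
      (\sum_(a | P a) \sum_(j < n.+1) entry (a, e) m j (entry (a, ~~ e) j p g)) :> M.
  move=> Pi; transitivity (\sum_(a | P a) \sum_(p < d i) \sum_(m < d i)
      word_op (n := n) xs (widen p) (widen m)
        (word_op (n := n) [:: (a, e); (a, ~~ e)] (widen m) (widen p) g : M)).
    apply: eq_bigr => a Pa; have dt := Pi a Pa; apply: qtrace_loops => //=.
      by rewrite dt andbT; case: (e); apply: eqxx.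
    by rewrite /wend /=; apply/eqP; move: dt; case: (e).
  rewrite exchange_big; apply: eq_bigr => p _.
  rewrite exchange_big; apply: eq_bigr => m _.
  rewrite raddf_sum; apply: eq_bigr => a _; congr (word_op _ _ _ _).
  exact: word_op_two.
rewrite (wE false) // (wE true) // sE.
have comb (f : {linear M -> M}) (A B D : M) (c c' c'' : k) :
    f A - f B - c *: f D + c' *: (c'' *: f D) = f (A - B - c *: D + c' *: (c'' *: D)).
  have fZ (a : k) (x : M) : f (a *: x) = a *: f x by exact: linearZ.
  by rewrite (raddfD f) !(raddfB f) /= !fZ.
rewrite -sumrB [X in _ - X]scaler_sumr -sumrB !scaler_sumr -big_split -sumrN.
apply: eq_bigr => p _ /=.
rewrite -sumrB [X in _ - X]scaler_sumr -sumrB !scaler_sumr -big_split -sumrN.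
apply: eq_bigr => m _ /=; set f := word_op xs (widen p) (widen m).
refine (etrans (comb f _ _ _ _ _ _) _); rewrite -[RHS](raddfN f); congr (f _).
rewrite (moment_normal_order dn) /theta tau_gl_elem /moment_character !trace_gl_elem.
rewrite [m == p]eq_sym -polyC_natr; move: (\sum_(a | _) _) ((p == m)%:R : K) => S b.
rewrite !opprD opprK -!addrA; do 2!congr (_ + _).
rewrite !scalerA -!scaleNr -!scalerDl; congr (_ *: _).
by rewrite !polyCM polyCB; ring.
Qed.

End Containment.

(** * Containment and uniqueness *)

Section Inclusion.
Variables (K : fieldType) (Q : quiver) (d : {ffun vertex Q -> nat}).
Local Notation k := {poly K}.
Local Notation M := {mpoly {poly K}[#|coordinate d|]}.
Implicit Types (g : M) (lam r : {ffun vertex Q -> K}) (chi : gl K d -> K) (v : gl K d).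

Lemma theta_qtrace lam chi v (x : dfree K Q) g :
  theta lam chi v (qtrace x g) = qtrace x (theta lam chi v g) :> M.
Proof.
have lx : linear (@qtrace K Q d x) by apply/Dhbar_linear/Dhbar_qtrace.
have Z (c : k) (f : M) : qtrace x (c *: f) = c *: qtrace x f :> M.
  have := lx c f 0; have x0 : qtrace x 0 = 0 :> M.
    by have := lx (-1) 0 0; rewrite scaler0 addr0 scaleN1r addNr.
  by rewrite x0 !addr0.
have D (f f' : M) : qtrace x (f + f') = qtrace x f + qtrace x f' :> M.
  by have := lx 1 f f'; rewrite !scale1r.
have N (f : M) : qtrace x (- f) = - qtrace x f :> M by rewrite -scaleN1r Z scaleN1r.
by rewrite /theta !D N !Z tau_qtrace.
Qed.

Lemma path_relation_left_ideal lam r (q : qpath Q) :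
  left_ideal (theta lam (moment_character (d := d) r))
    (qtrace (path_lift_w K q - path_lift_s lam q + hbar K *: path_lift_s r q)).
Proof.
case: q => [[i xs] cxs]; case: (eqVneq (wend i xs) i) => [exs|nxs].
  apply: (left_ideal_ext _ (fun g => esym (qtrace_path_relation lam r cxs g exs))).
  apply: (left_ideal_ext (left_ideal_scale (-1) _) (fun g => scaleN1r _)).
  apply: left_ideal_sum => p _; apply: left_ideal_sum => m _.
  by apply: left_ideal_comp; [apply: Dhbar_word_op | apply: left_ideal_gen].
apply: left_ideal_ext (left_ideal0 _) _ => g.
rewrite /path_lift_w /path_lift_s /= (negbTE nxs) subrr add0r qtrace_scale.
by rewrite /qtrace raddf0 scaler0.
Qed.

Lemma moment_rel_left_ideal lam r (x : dfree K Q) :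
  moment_rel lam r x -> left_ideal (theta lam (moment_character (d := d) r)) (qtrace x).
Proof.
case=> p ->{x}; pose x q := path_lift_w K q - path_lift_s lam q + hbar K *: path_lift_s r q.
have -> : lift_w p - lift_s lam p + hbar K *: lift_s r p
    = \sum_(q <- dom p) (coeff q p)%:P *: x q.
  rewrite /lift_w /lift_s /path_extend scaler_sumr -sumrB -big_split.
  by apply: eq_bigr => q _; rewrite /x scalerDr scalerBr !scalerA [hbar K * _]mulrC.
apply: (left_ideal_ext _ (fun g => esym (qtrace_sum _ _ _ g))).
apply: left_ideal_sum => q _.
apply: (left_ideal_ext _ (fun g => esym (qtrace_scale _ _ g))).
exact/left_ideal_scale/path_relation_left_ideal.
Qed.

Lemma moment_trace_contained lam r : trace_contained lam r (moment_character (d := d) r).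
Proof.
move=> x ix; split; last first.
  by move=> v g; rewrite scaler0 tau_qtrace subrr.
elim: ix => {x} [|x [rx|[x1 [m [x2 [mm ->]]]]]|c x y _ IHx _ IHy].
- by apply: left_ideal_ext (left_ideal0 _) _ => g; rewrite /qtrace raddf0.
- apply: left_ideal_ext (left_ideal0 _) _ => g.
  by rewrite (qtrace_relation (dim_le_sum d) _ rx).
- apply: (left_ideal_ext _ (fun g => esym (qtrace_mul _ _ g))).
  apply: (left_ideal_right (D := qtrace (qmul x1 m)) (Dhbar_qtrace d x2) (fun v g => theta_qtrace _ _ v x2 g)).
  apply: (left_ideal_ext _ (fun g => esym (qtrace_mul _ _ g))).
  exact: (left_ideal_comp (Dhbar_qtrace d x1) (moment_rel_left_ideal mm)).
apply: (left_ideal_ext _ (fun g => esym (qtraceP c x y g))).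
exact: left_ideal_add (left_ideal_scale c IHx) IHy.
Qed.

(** ** Uniqueness *)

Definition gl0 : gl K d := [ffun i => 0].

Lemma gl0E i : gl0 i = 0.
Proof. by rewrite ffunE. Qed.

Lemma character0 chi : character chi -> chi gl0 = 0.
Proof.
case=> lin _; have := lin (-1) gl0 gl0.
rewrite mulN1r addNr => <-; congr (chi _); apply/ffunP => i.
by rewrite !ffunE scaler0 addr0.
Qed.

Lemma gl_linE c v w i : gl_lin c v w i = c *: v i + w i.
Proof. by rewrite ffunE. Qed.

Lemma gl_bracketE v w i : gl_bracket v w i = v i *m w i - w i *m v i.
Proof. by rewrite ffunE. Qed.

Lemma gl_bracket_elem i (p q r s : 'I_(d i)) :
  gl_bracket (gl_elem K d i p q) (gl_elem K d i r s)
  = gl_lin (- (s == p)%:R) (gl_elem K d i r q)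
      (gl_lin (q == r)%:R (gl_elem K d i p s) gl0).
Proof.
apply/ffunP => j; rewrite gl_bracketE !gl_linE gl0E addr0.
case: (eqVneq j i) => [->|neq]; last first.
  by rewrite !gl_elem_neq // !mul0mx !scaler0 subrr addr0.
rewrite !gl_elem_delta !mul_delta_mx_cond -!scaler_nat scaleNr addrC.
by [].
Qed.

(** [[e_pp, e_pq] = e_pq] for [p != q]. *)
Lemma character_gl_elem chi i (p q : 'I_(d i)) :
  character chi ->
  chi (gl_elem K d i p q) = (p == q)%:R * chi (gl_elem K d i p p).
Proof.
move=> cchi; have [lin br] := cchi.
have := br (gl_elem K d i p p) (gl_elem K d i p q).
rewrite gl_bracket_elem !lin character0 // eqxx mul1r addr0.
case: eqVneq => [->|neq]; first by rewrite mul1r.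
by rewrite oppr0 !mul0r add0r.
Qed.

(** [[e_pq, e_qp] = e_pp - e_qq]. *)
Lemma character_gl_elem_diag chi i (p q : 'I_(d i)) :
  character chi -> chi (gl_elem K d i p p) = chi (gl_elem K d i q q).
Proof.
move=> cchi; have [lin br] := cchi.
have := br (gl_elem K d i p q) (gl_elem K d i q p).
rewrite gl_bracket_elem !lin character0 // !eqxx mul1r addr0 mulN1r.
by move/eqP; rewrite addrC subr_eq0 => /eqP.
Qed.

Lemma character_expand chi (v : gl K d) :
  character chi ->
  chi v = \sum_i \sum_p \sum_q v i p q * chi (gl_elem K d i p q).
Proof.
move=> cchi; have [lin _] := cchi.
pose I := {i : vertex Q & ('I_(d i) * 'I_(d i))%type}.
pose coef (t : I) := v (tag t) (tagged t).1 (tagged t).2.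
pose e (t : I) := gl_elem K d (tag t) (tagged t).1 (tagged t).2.
pose comb := foldr (fun t => gl_lin (coef t) (e t)) gl0.
have chiE s : chi (comb s) = \sum_(t <- s) coef t * chi (e t).
  elim: s => [|t s IH]; first by rewrite big_nil character0.
  by rewrite big_cons -IH -lin.
have combE s i : comb s i = \sum_(t <- s) coef t *: e t i.
  elim: s => [|t s IH]; first by rewrite big_nil gl0E.
  by rewrite big_cons -IH -gl_linE.
have vE : v = comb (enum {: I}).
  apply/ffunP => i; apply/matrixP => p q; rewrite combE summxE big_enum /=.
  rewrite (bigD1 (Tagged (fun i => ('I_(d i) * 'I_(d i))%type) (p, q))) //= big1 ?addr0.
    by rewrite mxE gl_elem_delta mxE !eqxx mulr1.
  case=> j [p' q'] /= neq; rewrite mxE /e /= ffunE mxE.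
  case: and3P => [[/eqP eqij /eqP eqp /eqP eqq]|_]; last by rewrite mulr0.
  subst j; case/eqP: neq.
  by rewrite (val_inj eqp : p = p') (val_inj eqq : q = q').
rewrite {1}vE chiE big_enum /=.
under [RHS]eq_bigr do rewrite pair_bigA.
by rewrite sig_big_dep; apply: eq_big.
Qed.

(** A character is a multiple of the trace on each [gl_(d_i)], and the trace of the
    identity is nonzero in characteristic zero unless [d_i = 0]. *)
Lemma character_ext chi chi' :
    [pchar K] =i pred0 -> character chi -> character chi' ->
    (forall i, \sum_(p < d i) chi (gl_elem K d i p p)
             = \sum_(p < d i) chi' (gl_elem K d i p p)) ->
  chi =1 chi'.
Proof.
move=> charK0 cchi cchi' eqtr v; rewrite !character_expand //.
apply: eq_bigr => i _; apply: eq_bigr => p _; apply: eq_bigr => q _; congr (_ * _).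
rewrite (character_gl_elem _ _ cchi) (character_gl_elem _ _ cchi'); congr (_ * _).
have := eqtr i; rewrite (eq_bigr (fun=> chi (gl_elem K d i p p))); last first.
  by move=> m _; apply: character_gl_elem_diag.
rewrite [X in _ = X](eq_bigr (fun=> chi' (gl_elem K d i p p))); last first.
  by move=> m _; apply: character_gl_elem_diag.
have di0 : (d i)%:R != 0 :> K by have /pcharf0P-> := charK0; rewrite -lt0n (leq_ltn_trans _ (ltn_ord p)).
rewrite !sumr_const card_ord -[LHS]mulr_natl -[RHS]mulr_natl.
exact: mulfI di0 _ _.
Qed.

(** The trivial path at [i] gives an element of the left ideal of [chi'] which is
    [- \sum_p (tau + \sum lambda tr - hbar chi) (e_pp)]; adding the corresponding
    sum of generators for [chi'] leaves a multiple of [hbar]. *)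
Lemma moment_character_unique lam r chi' :
    [pchar K] =i pred0 -> character chi' -> trace_contained lam r chi' ->
    ~ left_ideal (theta lam chi') (fun g => hbar K *: g) ->
  chi' =1 moment_character r.
Proof.
move=> charK0 cchi' cont nhbar v; apply/esym; move: v.
apply: character_ext => //; first exact: moment_characterP.
move=> i; apply/eqP; rewrite -subr_eq0 -sumrB; set c := \sum_(p | _) _.
apply/negP => /negP c0; apply: nhbar.
pose m : dfree K Q := path_lift_w K (exist _ (i, [::]) isT) - path_lift_s lam (exist _ (i, [::]) isT)
   + hbar K *: path_lift_s r (exist _ (i, [::]) isT).
have mrel : moment_rel lam r m.
  exists << exist _ (i, [::]) isT : qpath Q >>.
  have extE (F : qpath Q -> dfree K Q) q : path_extend F << q >> = F q.
    by rewrite /path_extend domU1 big_seq1 coeffU eqxx mulr1 scale1r.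
  by rewrite /lift_w /lift_s !extE.
have [inJ _] : invariants (left_ideal (theta lam chi'))
    (qtrace (qmul (qmul (dbase K [::]) m) (dbase K [::]))).
  by apply: cont; apply: lspan_gen; right; exists (dbase K [::]), m, (dbase K [::]).
have unitE g : qtrace (dbase K [::]) g = g.
  rewrite qtrace_dbase (trace_diagramE (dim_le_sum d)) //.
  by rewrite /diagram_op /by_height /= /weight big_nil scale1r.
pose th' g := \sum_(p < d i) theta lam chi' (gl_elem K d i p p) g.
have th'J : left_ideal (theta lam chi') th'.
  by apply: left_ideal_sum => p _; apply: left_ideal_gen.
apply: (left_ideal_ext (left_ideal_scale (c^-1)%:P (left_ideal_add inJ th'J))) => g.
rewrite !qtrace_mul !unitE qtrace_path_relation //.
rewrite -sumrN -big_split /=.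
transitivity ((c^-1)%:P *: \sum_(p < d i) (hbar K * (moment_character r (gl_elem K d i p p)
    - chi' (gl_elem K d i p p))%:P) *: g).
  congr (_ *: _); apply: eq_bigr => p _.
  rewrite (sum_single _ (j := p)) => [|q neq]; last first.
    rewrite /= -val_eqE /= eq_sym (negbTE (_ : (q : nat) != p)) ?scale0r //.
  by rewrite /= eqxx scale1r /theta opprB addrA subrK -scalerBl -mulrBr -polyCB.
by rewrite -scaler_suml scalerA -mulr_sumr mulrCA -rmorph_sum -rmorphM /= mulVf // mulr1.
Qed.

End Inclusion.

(* If hbar lies in the left ideal attached to chi', then it contains every
   multiple of hbar and the containment holds whatever the values of chi' (this
   happens e.g. as soon as \sum_i d_i c_i <> 0, where chi' = \sum_i c_i tr_i).
   Uniqueness is stated against all the other characters. *)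
Theorem corollary3p20 (K : closedFieldType) (charK0 : [pchar K] =i pred0)
    (Q : quiver) (d : {ffun vertex Q -> nat}) (r : {ffun vertex Q -> K}) :
  exists2 chi : gl K d -> K, character chi &
    forall lam : {ffun vertex Q -> K},
      \sum_(i : vertex Q) lam i * (d i)%:R = 0 ->
      trace_contained lam r chi /\
      (forall chi' : gl K d -> K,
         character chi' -> trace_contained lam r chi' ->
         ~ left_ideal (theta lam chi') (fun g => hbar K *: g) ->
         chi' =1 chi).
Proof.
exists (moment_character r); first exact: moment_characterP.
move=> lam _; split=> [|chi' cchi' cont nhbar]; first exact: moment_trace_contained.
exact: moment_character_unique charK0 cchi' cont nhbar.
Qed.
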